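(* Let $\mathfrak g=\mathfrak b\oplus\mathfrak c$ be a six-dimensional decomposable, unimodular, non-nilpotent, solvable real Lie algebra admitting a complex structure with a non-zero closed $(3,0)$-form. Then $\mathfrak g$ is isomorphic to $\mathfrak e(2)\oplus\mathfrak e(1,1)$, to $A_{5,7}^{-1,-1,1}\oplus\mathbb R$, or to $A_{5,17}^{\alpha,-\alpha,1}\oplus\mathbb R$ for some $\alpha\ge 0$, where $$ \begin{aligned} \mathfrak e(2)\oplus\mathfrak e(1,1)&=(0,-e^{13},e^{12},0,-e^{46},-e^{45}),\\ A_{5,7}^{-1,-1,1}\oplus\mathbb R&=(e^{15},-e^{25},-e^{35},e^{45},0,0),\\ A_{5,17}^{\alpha,-\alpha,1}\oplus\mathbb R&=(\alpha e^{15}+e^{25},\,-e^{15}+\alpha e^{25},\,-\alpha e^{35}+e^{45},\,-e^{35}-\alpha e^{45},\,0,\,0). \end{aligned} $$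
   Context: A Lie algebra is decomposable if it is the direct sum of two non-zero ideals. The notation $\mathfrak g=(\epsilon_1,\dots,\epsilon_6)$ means that $\mathfrak g$ is the real Lie algebra whose dual has a basis $\{e^1,\dots,e^6\}$ with $de^i=\epsilon_i$, where $d$ is the Chevalley–Eilenberg differential ($d\alpha(X,Y)=-\alpha([X,Y])$) and $e^{ij}=e^i\wedge e^j$. A complex structure on $\mathfrak g$ is an endomorphism $J$ with $J^2=-I$ and vanishing Nijenhuis tensor; bidegrees of forms in $\Lambda^*\mathfrak g^*\otimes\mathbb C$ are taken with respect to $J$, a $1$-form $\eta$ being of type $(1,0)$ if $\eta\circ J=i\eta$. *)

(* Defs.v *)
From HB Require Import structures.
From mathcomp Require Import all_boot all_order all_algebra.
From mathcomp Require Import reals.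
From mathcomp Require Import complex.
From mathcomp Require Import ring.

Set Implicit Arguments.
Unset Strict Implicit.
Unset Printing Implicit Defensive.

Import GRing.Theory.

Local Open Scope ring_scope.

Record lieBracket (R : realType) (V : vectType R) := LieBracket {
  bracket :> V -> V -> V;
  bracket_linearl : forall y, linear (fun x => bracket x y);
  bracket_linearr : forall x, linear (bracket x);
  bracket_alt : forall x, bracket x x = 0;
  bracket_jacobi : forall x y z,
    bracket x (bracket y z) + bracket y (bracket z x)
      + bracket z (bracket x y) = 0 }.

Section LieAlgebra.
Variables (R : realType) (V : vectType R) (L : lieBracket V).

(* [U, W]: the span of all brackets [u, w] with u in U and w in W
   (see bracketv_subP); by bilinearity basis vectors suffice. *)
Definition bracketv (U W : {vspace V}) : {vspace V} :=
  <<[seq L u w | u <- vbasis U, w <- vbasis W]>>%VS.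

Lemma bracketv_subP (U W T : {vspace V}) :
  (bracketv U W <= T)%VS <->
  (forall u w, u \in U -> w \in W -> L u w \in T).
Proof.
pose Ll w : {linear V -> V} :=
  HB.pack (fun x => L x w) (GRing.isLinear.Build _ _ _ _ _ (bracket_linearl L w)).
pose Lr u : {linear V -> V} :=
  HB.pack (L u) (GRing.isLinear.Build _ _ _ _ _ (bracket_linearr L u)).
split=> [/span_subvP sT u w Uu Ww | sT]; last first.
  apply/span_subvP=> _ /allpairsP[[u w] /= [Uu Ww ->]].
  by apply: sT; apply: vbasis_mem.
rewrite -[L _ _]/(Ll w u) (coord_vbasis Uu) linear_sum.
apply: rpred_sum => i _; rewrite linearZ rpredZ //.
rewrite -[Ll _ _]/(Lr (vbasis U)`_i w) (coord_vbasis Ww) linear_sum.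
apply: rpred_sum => j _; rewrite linearZ rpredZ //.
by apply: sT; apply: allpairs_f; rewrite mem_nth ?size_tuple.
Qed.

Definition lower_central (n : nat) : {vspace V} :=
  iter n (bracketv fullv) fullv.

Definition derived_series (n : nat) : {vspace V} :=
  iter n (fun U => bracketv U U) fullv.

Definition nilpotent := exists n, lower_central n = 0%VS.

Definition solvable := exists n, derived_series n = 0%VS.

Definition ideal (I : {vspace V}) :=
  forall x y, y \in I -> L x y \in I.

Definition decomposable := exists b c : {vspace V},
  [/\ ideal b, ideal c, b != 0%VS, c != 0%VS &
      directv (b + c) /\ (b + c)%VS = fullv].

Definition ad (x : V) : 'End(V) := linfun (L x).

Definition lfun_trace (f : 'End(V)) : R :=
  \tr (passmx.mxof (vbasis fullv) (vbasis fullv) f).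

Definition unimodular := forall x, lfun_trace (ad x) = 0.

Definition nijenhuis (J : 'End(V)) (x y : V) : V :=
  L x y + J (L (J x) y) + J (L x (J y)) - L (J x) (J y).

Definition complex_structure (J : 'End(V)) :=
  (forall x, J (J x) = - x) /\ (forall x y, nijenhuis J x y = 0).

(* Complex-valued forms are R-multilinear maps into the complex numbers;
   Rcomplex R is R[i] viewed as an algebra over R. *)
Definition type10 (J : 'End(V)) (eta : {linear V -> Rcomplex R}) :=
  forall x, eta (J x) = 'i%C * eta x.

Definition wedge3 (eta : 'I_3 -> {linear V -> Rcomplex R}) (x y z : V) :
    Rcomplex R :=
  \det (\matrix_(i < 3, j < 3) eta i (tnth [tuple x; y; z] j)).

(* The (3,0)-forms are the finite sums of products of three (1,0)-forms;
   complex coefficients are absorbed in the (1,0)-forms. *)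
Definition type30 (J : 'End(V)) (psi : V -> V -> V -> Rcomplex R) :=
  exists (n : nat) (eta : 'I_n -> 'I_3 -> {linear V -> Rcomplex R}),
    (forall k i, type10 J (eta k i)) /\
    (forall x y z, psi x y z = \sum_(k < n) wedge3 (eta k) x y z).

(* The Chevalley-Eilenberg differential in degrees 1 and 3, i.e.
   (d psi)(x_0, ..., x_p) is the sum over i < j of
   (-1)^(i+j) psi([x_i, x_j], x_0, ..., x_p) with x_i and x_j omitted. *)
Definition d1 (A : zmodType) (alpha : V -> A) (x y : V) : A :=
  - alpha (L x y).

Definition d3 (A : zmodType) (psi : V -> V -> V -> A) (x y z t : V) : A :=
  - psi (L x y) z t + psi (L x z) y t - psi (L x t) y z
  - psi (L y z) x t + psi (L y t) x z - psi (L z t) x y.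

Definition closed3 (A : zmodType) (psi : V -> V -> V -> A) :=
  forall x y z t, d3 psi x y z t = 0.

Definition has_nonzero_closed_30_form (J : 'End(V)) :=
  exists psi : V -> V -> V -> Rcomplex R,
    [/\ type30 J psi, closed3 psi & exists x y z, psi x y z != 0].

End LieAlgebra.

Definition lie_isomorphic (R : realType) (V W : vectType R)
    (L : lieBracket V) (M : lieBracket W) :=
  exists f : 'Hom(V, W),
    bijective f /\ (forall x y, f (L x y) = M (f x) (f y)).

Section Models.
Variable R : realType.
Implicit Types x y z : 'rV[R]_6.

(* e^i and e^{ij}, with indices running from 1 to 6. *)
Definition edual (i : nat) x : R := x 0 (inord i.-1).
Definition edual2 (i j : nat) x y : R :=
  edual i x * edual j y - edual i y * edual j x.

(* The bracket on R^6 for which d e^i = eps_i (see d1_eqs_bracket). *)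
Definition eqs_bracket (eps : 'rV[R]_6 -> 'rV[R]_6 -> seq R) x y : 'rV[R]_6 :=
  \row_(i < 6) - (eps x y)`_i.

Local Notation e := edual2.

Definition e2_e11_eqs x y : seq R :=
  [:: 0; - e 1 3 x y; e 1 2 x y; 0; - e 4 6 x y; - e 4 5 x y].

Definition A57_eqs x y : seq R :=
  [:: e 1 5 x y; - e 2 5 x y; - e 3 5 x y; e 4 5 x y; 0; 0].

Definition A517_eqs (a : R) x y : seq R :=
  [:: a * e 1 5 x y + e 2 5 x y; - e 1 5 x y + a * e 2 5 x y;
      - a * e 3 5 x y + e 4 5 x y; - e 3 5 x y - a * e 4 5 x y; 0; 0].

Local Ltac lie_axiom :=
  apply/rowP; case=> [[|[|[|[|[|[|//]]]]]] ?];
  rewrite /= !mxE /e2_e11_eqs /A57_eqs /A517_eqs /edual2 /edual /=;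
  rewrite ?mxE ?inordK //=;
  rewrite /e2_e11_eqs /A57_eqs /A517_eqs /edual2 /edual /=;
  rewrite ?mxE ?inordK //=; try ring.

Fact e2_e11_linearl y : linear (fun x => eqs_bracket e2_e11_eqs x y).
Proof. by move=> k u v; lie_axiom. Qed.
Fact e2_e11_linearr x : linear (eqs_bracket e2_e11_eqs x).
Proof. by move=> k u v; lie_axiom. Qed.
Fact e2_e11_alt x : eqs_bracket e2_e11_eqs x x = 0.
Proof. by lie_axiom. Qed.
Fact e2_e11_jacobi x y z :
  let br := eqs_bracket e2_e11_eqs in
  br x (br y z) + br y (br z x) + br z (br x y) = 0.
Proof. by lie_axiom. Qed.
Definition e2_e11 : lieBracket 'rV[R]_6 :=
  LieBracket e2_e11_linearl e2_e11_linearr e2_e11_alt e2_e11_jacobi.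

Fact A57_R_linearl y : linear (fun x => eqs_bracket A57_eqs x y).
Proof. by move=> k u v; lie_axiom. Qed.
Fact A57_R_linearr x : linear (eqs_bracket A57_eqs x).
Proof. by move=> k u v; lie_axiom. Qed.
Fact A57_R_alt x : eqs_bracket A57_eqs x x = 0.
Proof. by lie_axiom. Qed.
Fact A57_R_jacobi x y z :
  let br := eqs_bracket A57_eqs in
  br x (br y z) + br y (br z x) + br z (br x y) = 0.
Proof. by lie_axiom. Qed.
Definition A57_R : lieBracket 'rV[R]_6 :=
  LieBracket A57_R_linearl A57_R_linearr A57_R_alt A57_R_jacobi.

Fact A517_R_linearl (a : R) y : linear (fun x => eqs_bracket (A517_eqs a) x y).
Proof. by move=> k u v; lie_axiom. Qed.
Fact A517_R_linearr (a : R) x : linear (eqs_bracket (A517_eqs a) x).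
Proof. by move=> k u v; lie_axiom. Qed.
Fact A517_R_alt (a : R) x : eqs_bracket (A517_eqs a) x x = 0.
Proof. by lie_axiom. Qed.
Fact A517_R_jacobi (a : R) x y z :
  let br := eqs_bracket (A517_eqs a) in
  br x (br y z) + br y (br z x) + br z (br x y) = 0.
Proof. by lie_axiom. Qed.
Definition A517_R (a : R) : lieBracket 'rV[R]_6 :=
  LieBracket (A517_R_linearl a) (A517_R_linearr a)
    (A517_R_alt a) (A517_R_jacobi a).

Lemma d1_eqs_bracket (L : lieBracket 'rV[R]_6) eps :
  (forall x y, L x y = eqs_bracket eps x y) ->
  forall i x y, (0 < i <= 6)%N -> d1 L (edual i) x y = (eps x y)`_i.-1.
Proof.
move=> Leps [//|i] x y /= lti.
by rewrite /d1 /edual Leps mxE /= inordK // opprK.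
Qed.

End Models.

(* Main.v *)
Require Import Defs.
From HB Require Import structures.
From mathcomp Require Import all_boot all_order all_algebra.
From mathcomp Require Import reals.
From mathcomp Require Import complex.
From mathcomp Require Import ring lra.

Set Implicit Arguments.
Unset Strict Implicit.
Unset Printing Implicit Defensive.

Import Order.TTheory GRing.Theory Num.Theory.

Local Open Scope ring_scope.

(** Everything is read off the subalgebra of (0,1)-vectors, without a list of the
    solvable Lie algebras of dimension 5.  Through x |-> x + i J x, the space V
    is identified with the complex subalgebra h of (0,1)-vectors of the
    complexification g_C.  The bracket of h becomes [mu x y = [x, y] - [J x, J y]], and the action of h on g_C / h, which
    is again V, becomes [rho x y = [x, y] + J [J x, y]].  A non-zero (3,0)-form is
    a volume form on g_C / h; being closed, it makes every [rho x] traceless, and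
    unimodularity then makes h unimodular ([rho_trace], [mu_trace]).  Over the
    reals this says that ad x and J ad x both have trace zero ([trace_J_ad]).

    Suppose that some central z lies outside [g, g], and let zeta be a linear
    form with zeta z = 1 that vanishes on [g, g].  Then D = ad (J z) commutes
    with J.  On W = ker zeta /\ ker (zeta J), a complex plane, mu vanishes since
    h is unimodular; so the operators rho x, x in W, commute, and as traceless
    2 x 2 matrices they are proportional: some u <> 0 in W has rho u = 0 modulo z
    ([exists_rho_null]).  In a basis (u, v) of W the relation
    rho (D y) = [D, rho y] and the Jacobi identity leave two possibilities: g is
    nilpotent, or D is diagonalizable on W with eigenvalues l, - l (l <> 0) and W
    is abelian ([central_factor_structure]).  Real l gives A_{5,7}, the others
    give A_{5,17}.

    An ideal that is a direct factor is unimodular, hence abelian if its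
    dimension is at most 2, and then any non-zero vector of it is such a z.  There
    remains the product of two non-abelian factors of dimension 3.  By
    solvability their derived algebras have dimension 1 (Heisenberg) or 2; in the
    second case the factor is a plane P extended by some t with (ad t)^2 = 1 or
    - 1 on P ([plane_factor_of_dim2]).
    Two Heisenberg factors give a nilpotent algebra.  For a Heisenberg factor
    with centre z and a plane factor, ad (J z) commutes with J, and counting
    dimensions in its image shows that J z is central and outside [g, g]
    ([heisenberg_times_plane]).  For two plane factors the sum N of both planes is
    J-stable ([N_stable]) and (rho t)^2 is a complex scalar on N; comparing its
    values on the two planes forces the two signs to be opposite
    ([two_plane_signs]), which is e(2) + e(1,1). *)

(** * Vector identities and brackets *)
Section VectorIdentities.
Variables (R : realType) (V : vectType R).

(** Linear forms separate points.  This turns an identity between linear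
    combinations in V into one between real numbers, which [ring] and [field]
    decide. *)
Lemma scalar_ext (x y : V) : (forall f : {scalar V}, f x = f y) -> x = y.
Proof.
move=> fE; rewrite (coord_vbasis (memvf x)) (coord_vbasis (memvf y)).
by apply: eq_bigr => i _; congr (_ *: _); apply: (fE (coord (vbasis fullv) i)).
Qed.

Lemma lfD (W : vectType R) (f : 'Hom(V, W)) x y : f (x + y) = f x + f y.
Proof. exact: linearD. Qed.
Lemma lfN (W : vectType R) (f : 'Hom(V, W)) x : f (- x) = - f x.
Proof. exact: linearN. Qed.
Lemma lfZ (W : vectType R) (f : 'Hom(V, W)) a x : f (a *: x) = a *: f x.
Proof. exact: linearZ. Qed.
Lemma lf0 (W : vectType R) (f : 'Hom(V, W)) : f 0 = 0.
Proof. exact: linear0. Qed.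

Lemma scD (f : {scalar V}) x y : f (x + y) = f x + f y.
Proof. exact: linearD. Qed.
Lemma scN (f : {scalar V}) x : f (- x) = - f x.
Proof. exact: linearN. Qed.
Lemma scZ (f : {scalar V}) a x : f (a *: x) = a * f x.
Proof. exact: linearZ. Qed.
Lemma sc0 (f : {scalar V}) : f 0 = 0.
Proof. exact: linear0. Qed.

End VectorIdentities.

Definition lfE := (lfD, lfN, lfZ, lf0).
Definition scE := (scD, scN, scZ, sc0).

Ltac vring := apply: scalar_ext => f; rewrite ?lfE ?scE; ring.
Ltac vfield := apply: scalar_ext => f; rewrite ?lfE ?scE; field.

Section Bracket.
Variables (R : realType) (V : vectType R) (L : lieBracket V).
Implicit Types x y z : V.

Lemma brDl x x' y : L (x + x') y = L x y + L x' y.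
Proof. by have := bracket_linearl L y 1 x x'; rewrite !scale1r. Qed.
Lemma brDr x y y' : L x (y + y') = L x y + L x y'.
Proof. by have := bracket_linearr L x 1 y y'; rewrite !scale1r. Qed.
Lemma br0l y : L 0 y = 0.
Proof. by apply: (addrI (L 0 y)); rewrite -brDl !addr0. Qed.
Lemma br0r x : L x 0 = 0.
Proof. by apply: (addrI (L x 0)); rewrite -brDr !addr0. Qed.
Lemma brZl a x y : L (a *: x) y = a *: L x y.
Proof. by have := bracket_linearl L y a x 0; rewrite br0l !addr0. Qed.
Lemma brZr a x y : L x (a *: y) = a *: L x y.
Proof. by have := bracket_linearr L x a y 0; rewrite br0r !addr0. Qed.
Lemma brNl x y : L (- x) y = - L x y.
Proof. by rewrite -scaleN1r brZl scaleN1r. Qed.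
Lemma brNr x y : L x (- y) = - L x y.
Proof. by rewrite -scaleN1r brZr scaleN1r. Qed.
Definition brE := (brDl, brDr, brNl, brNr, brZl, brZr, br0l, br0r).

Lemma brC x y : L x y = - L y x.
Proof.
have := bracket_alt L (x + y); rewrite !brE !bracket_alt addr0 add0r.
by move/eqP; rewrite addr_eq0 => /eqP.
Qed.

Lemma jacobi_der x y z : L x (L y z) = L (L x y) z + L y (L x z).
Proof.
have := bracket_jacobi L x y z.
rewrite (brC z (L x y)) (brC z x) brNr => /eqP.
by rewrite subr_eq0 subr_eq => /eqP.
Qed.

Lemma jacobi_br x y z : L (L x y) z = L x (L y z) - L y (L x z).
Proof. by rewrite (jacobi_der x y z) addrK. Qed.

Lemma adE x y : ad L x y = L x y.
Proof.
rewrite /ad; pose h := GRing.isLinear.Build _ _ _ _ (L x) (bracket_linearr L x).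
pose Lx : {linear V -> V} := HB.pack (L x : V -> V) h.
by rewrite -[L x]/(Lx : V -> V) lfunE.
Qed.
(** The criterion by which every degenerate case is excluded: the chain
    V > T1 > T2 > 0 dominates the lower central series. *)
Lemma nilpotent_of_chain (T1 T2 : {vspace V}) : (forall x y, L x y \in T1) ->
  (forall x y, y \in T1 -> L x y \in T2) -> (forall x y, y \in T2 -> L x y = 0) ->
  nilpotent L.
Proof.
move=> h1 h2 h3; exists 3; apply/eqP; rewrite -subv0 /lower_central /=.
have s1 : (bracketv L fullv fullv <= T1)%VS by apply/bracketv_subP => x y _ _; exact: h1.
have s2 : (bracketv L fullv (bracketv L fullv fullv) <= T2)%VS.
  by apply/bracketv_subP => x y _ /(subvP s1); exact: h2.
by apply/bracketv_subP => x y _ /(subvP s2) /(h3 x) ->; exact: mem0v.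
Qed.

End Bracket.

(** * Traces of endomorphisms *)
Section Trace.
Variables (R : realType) (V : vectType R).

Lemma lfun_traceE (f : 'End(V)) :
  lfun_trace f = \sum_i coord (vbasis fullv) i (f (vbasis fullv)`_i).
Proof.
rewrite /lfun_trace /mxtrace; apply: eq_bigr => i _.
by rewrite !mxE /= passmx.vecof_delta.
Qed.

(** f is a sum of rank one operators v |-> phi_i v X_i.  The X_i need not be a
    basis of V, so it suffices to expand f on its image. *)
Lemma lfun_trace_sum n (phi : 'I_n -> {scalar V}) (X : 'I_n -> V) (f : 'End(V)) :
  (forall v, f v = \sum_i phi i v *: X i) -> lfun_trace f = \sum_i phi i (X i).
Proof.
move=> fE; rewrite lfun_traceE.
transitivity (\sum_(j < \dim {:V}) \sum_i phi i (vbasis fullv)`_j * coord (vbasis fullv) j (X i)).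
  apply: eq_bigr => j _; rewrite fE linear_sum.
  by apply: eq_bigr => i _; rewrite linearZ.
rewrite exchange_big; apply: eq_bigr => i _ /=.
rewrite [in RHS](coord_vbasis (memvf (X i))) linear_sum.
by apply: eq_bigr => j _; rewrite linearZ mulrC.
Qed.

Lemma lfun_traceD (f g : 'End(V)) :
  lfun_trace (f + g) = lfun_trace f + lfun_trace g.
Proof.
rewrite !lfun_traceE -big_split; apply: eq_bigr => i _.
by rewrite lfunE linearD.
Qed.

Lemma lfun_traceN (f : 'End(V)) : lfun_trace (- f) = - lfun_trace f.
Proof.
by rewrite !lfun_traceE -sumrN; apply: eq_bigr => i _; rewrite lfunE /= linearN.
Qed.

Lemma lfun_traceC (f g : 'End(V)) :
  lfun_trace (f \o g)%VF = lfun_trace (g \o f)%VF.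
Proof.
pose phi (i : 'I_(\dim {:V})) : {scalar V} := coord (vbasis fullv) i \o g.
rewrite (lfun_trace_sum (phi := phi) (X := fun i => f (vbasis fullv)`_i)).
  by rewrite lfun_traceE; apply: eq_bigr => i _; rewrite comp_lfunE.
move=> v; rewrite comp_lfunE {1}(coord_vbasis (memvf (g v))) linear_sum.
by apply: eq_bigr => i _; rewrite linearZ.
Qed.

End Trace.

(** * V as a complex vector space *)
Section ComplexNumbers.
Variables (R : realType).
Implicit Types x y : R[i].
Lemma cjD x y : (x + y)^*%C = x^*%C + y^*%C. Proof. exact: rmorphD. Qed.
Lemma cjN x : (- x)^*%C = - x^*%C. Proof. exact: rmorphN. Qed.
Lemma cjM x y : (x * y)^*%C = x^*%C * y^*%C. Proof. exact: rmorphM. Qed.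
Definition cjE := (cjD, cjN, cjM, @conjc0 R, @conjc1 R).
Lemma double_eq0 x : 2 * x = 0 -> x = 0.
Proof. by move/eqP; rewrite mulf_eq0 pnatr_eq0 => /eqP. Qed.
Lemma eq_opp_eq0 x : x = - x -> x = 0.
Proof. by move/eqP; rewrite -addr_eq0 -mulr2n mulrn_eq0 => /eqP. Qed.
End ComplexNumbers.

(** Multiplication by a complex number, i acting as J.  It is locked since
    rewriting would otherwise see the sum in its body. *)
HB.lock Definition cscale (R : realType) (V : vectType R) (J : 'End(V))
  (a : R[i]) (x : V) : V := complex.Re a *: x + complex.Im a *: J x.

Section ComplexScalars.
Variables (R : realType) (V : vectType R) (J : 'End(V)).
Hypothesis JJ : forall x, J (J x) = - x.
Implicit Types (x y : V) (a b c : R[i]).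

Local Notation "a *j x" := (cscale J a x) (at level 40).

Lemma cscaleE a x : a *j x = complex.Re a *: x + complex.Im a *: J x.
Proof. by rewrite unlock. Qed.

Lemma cscaleDr a x y : a *j (x + y) = a *j x + a *j y.
Proof. by rewrite ?cscaleE; vring. Qed.
Lemma cscaleDl a b x : (a + b) *j x = a *j x + b *j x.
Proof. by case: a b => [a a'] [b b']; rewrite ?cscaleE /=; vring. Qed.
Lemma cscaleA a b x : a *j (b *j x) = (a * b) *j x.
Proof.
case: a b => [a a'] [b b']; by rewrite ?cscaleE /= !lfE JJ; vring.
Qed.
Lemma cscaler0 a : a *j 0 = 0.
Proof. by rewrite ?cscaleE !linear0 addr0. Qed.
Lemma cscale0r x : 0 *j x = 0.
Proof. by rewrite ?cscaleE /= !scale0r addr0. Qed.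
Lemma cscale1r x : 1 *j x = x.
Proof. by rewrite ?cscaleE /= scale1r scale0r addr0. Qed.
Lemma cscaleir x : 'i%C *j x = J x.
Proof. by rewrite ?cscaleE /= scale1r scale0r add0r. Qed.
Lemma cscaleR (r : R) x : r%:C%C *j x = r *: x.
Proof. by rewrite ?cscaleE /= scale0r addr0. Qed.
Lemma cscaleNr a x : a *j (- x) = - (a *j x).
Proof. by rewrite ?cscaleE; vring. Qed.
Lemma cscaleNl a x : (- a) *j x = - (a *j x).
Proof. by case: a => [a a']; rewrite ?cscaleE /=; vring. Qed.
Lemma cscale_eq0 a x : a *j x = 0 -> a = 0 \/ x = 0.
Proof.
move=> ax0; case: (eqVneq a 0) => [|a0]; [by left|right].
by rewrite -(cscale1r x) -(mulVf a0) -cscaleA ax0 cscaler0.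
Qed.

Lemma cscale_sum2_eq0 a b x y : a != 0 -> a *j x + b *j y = 0 ->
  x = (- (a^-1 * b)) *j y.
Proof.
move=> a0 /(congr1 (cscale J a^-1)); rewrite cscaleDr !cscaleA mulVf // cscale1r.
by rewrite cscaler0 cscaleNl => /eqP; rewrite addr_eq0 => /eqP.
Qed.

Definition Clinear (c : V -> R[i]) :=
  (forall x y, c (x + y) = c x + c y) /\ (forall a x, c (a *j x) = a * c x).

Section ClinearTheory.
Variables (c : V -> R[i]) (cL : Clinear c).
Lemma ClinD x y : c (x + y) = c x + c y. Proof. exact: cL.1. Qed.
Lemma ClinZ a x : c (a *j x) = a * c x. Proof. exact: cL.2. Qed.
Lemma ClinR (r : R) x : c (r *: x) = r%:C%C * c x.
Proof. by rewrite -cscaleR ClinZ. Qed.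
Lemma ClinN x : c (- x) = - c x.
Proof. by rewrite -scaleN1r ClinR rmorphN1 mulN1r. Qed.
Lemma Clin0 : c 0 = 0.
Proof. by rewrite -(scale0r 0) ClinR mul0r. Qed.
Lemma ClinJ x : c (J x) = 'i%C * c x.
Proof. by rewrite -cscaleir ClinZ. Qed.
Definition ClinE := (ClinD, ClinN, ClinZ, ClinR, ClinJ, Clin0).
End ClinearTheory.

Definition cindep2 x y := forall a b, a *j x + b *j y = 0 -> a = 0 /\ b = 0.
Definition cindep3 x y z :=
  forall a b c, a *j x + b *j y + c *j z = 0 -> [/\ a = 0, b = 0 & c = 0].

(** A complex basis of (V, J) together with its dual coordinates. *)
Record cframe := CFrame {
  fr0 : V; fr1 : V; fr2 : V;
  co0 : V -> R[i]; co1 : V -> R[i]; co2 : V -> R[i];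
  co0L : Clinear co0; co1L : Clinear co1; co2L : Clinear co2;
  frameE : forall v, v = co0 v *j fr0 + co1 v *j fr1 + co2 v *j fr2;
  co0E : [/\ co0 fr0 = 1, co0 fr1 = 0 & co0 fr2 = 0];
  co1E : [/\ co1 fr0 = 0, co1 fr1 = 1 & co1 fr2 = 0];
  co2E : [/\ co2 fr0 = 0, co2 fr1 = 0 & co2 fr2 = 1] }.

Lemma cspan2_mem a b x y : a *j x + b *j y \in <<[:: x; J x; y; J y]>>%VS.
Proof.
rewrite ?cscaleE; do ![apply: memvD]; apply: memvZ; apply: memv_span;
  by rewrite !inE eqxx ?orbT.
Qed.

Lemma dim_notin (U : {vspace V}) : (\dim U < \dim {:V})%N -> exists v, v \notin U.
Proof.
move=> ltU; case: (pickP (fun i : 'I_(\dim {:V}) => (vbasis fullv)`_i \notin U)).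
  by move=> i Hi; exists (vbasis fullv)`_i.
move=> H; suff : ({:V} <= U)%VS by move/dimvS; rewrite leqNgt ltU.
apply/subvP => v _; rewrite (coord_vbasis (memvf v)); apply: rpred_sum => i _.
by apply: memvZ; have := H i => /negbFE.
Qed.

Hypothesis dimV : \dim {:V} = 6%N.

Lemma cindep3_ext x y : cindep2 x y -> exists z, cindep3 x y z.
Proof.
move=> xy; have [|z zU] := @dim_notin <<[:: x; J x; y; J y]>>%VS.
  by rewrite dimV; apply: leq_ltn_trans (dim_span _) _.
exists z => a b c H; have c0 : c = 0.
  apply/eqP; case: eqP => // /eqP c0; case/negP: zU.
  have -> : z = (- (c^-1 * a)) *j x + (- (c^-1 * b)) *j y.
    move: (congr1 (cscale J c^-1) H); rewrite !cscaleDr !cscaleA mulVf // cscale1r.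
    by rewrite cscaler0 !cscaleNl addrC => /eqP; rewrite addr_eq0 opprD => /eqP.
  exact: cspan2_mem.
by move: H; rewrite c0 cscale0r addr0 => /xy[].
Qed.

Lemma cindep2_ext x : x != 0 -> exists y, cindep2 x y.
Proof.
move=> x0; have [|y yU] := @dim_notin <<[:: x; J x; 0%R; J 0%R]>>%VS.
  by rewrite dimV; apply: leq_ltn_trans (dim_span _) _.
exists y => a b H; have b0 : b = 0.
  apply/eqP; case: eqP => // /eqP b0; case/negP: yU.
  rewrite addrC in H; rewrite (cscale_sum2_eq0 b0 H).
  by have := cspan2_mem (- (b^-1 * a)) 0 x 0; rewrite cscaler0 addr0.
move: H; rewrite b0 cscale0r addr0 => /cscale_eq0[//|xz].
by rewrite xz eqxx in x0.
Qed.

(** The real basis (x, J x, y, J y, z, J z) gives the real and imaginary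
    parts of the complex coordinates. *)
Lemma cframe_of x y z : cindep3 x y z ->
  exists F : cframe, [/\ fr0 F = x, fr1 F = y & fr2 F = z].
Proof.
move=> xyz; pose X := [tuple x; J x; y; J y; z; J z].
have Xfree : free X.
  apply/freeP => k; rewrite !big_ord_recr big_ord0 /= add0r => H.
  have [] := xyz (k ord0 +i* k (inord 1))%C (k (inord 2) +i* k (inord 3))%C
     (k (inord 4) +i* k (inord 5))%C.
    rewrite -[RHS]H !cscaleE /= -!addrA.
    by congr (_ *: _ + (_ *: _ + (_ *: _ + (_ *: _ + (_ *: _ + _ *: _)))));
    congr k; apply: val_inj; rewrite /= ?inordK.
  case=> k0 k1 [k2 k3] [k4 k5] i.
  case: i => [[|[|[|[|[|[|//]]]]]] Hi];
    [move: k0|move: k1|move: k2|move: k3|move: k4|move: k5];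
    by move=> <-; congr k; apply: val_inj; rewrite /= ?inordK.
have Xb : basis_of fullv X by rewrite basisEfree Xfree subvf dimV.
pose co (j : 'I_6) (j' : 'I_6) v := (coord X j v +i* coord X j' v)%C.
pose i0 : 'I_6 := ord0; pose i1 : 'I_6 := Ordinal (isT : (1 < 6)%N).
pose i2 : 'I_6 := Ordinal (isT : (2 < 6)%N).
pose i3 : 'I_6 := Ordinal (isT : (3 < 6)%N).
pose i4 : 'I_6 := Ordinal (isT : (4 < 6)%N).
pose i5 : 'I_6 := Ordinal (isT : (5 < 6)%N).
have vE v : v = co i0 i1 v *j x + co i2 i3 v *j y + co i4 i5 v *j z.
  rewrite {1}(coord_basis Xb (memvf v)) !big_ord_recr big_ord0 /= add0r.
  rewrite ?cscaleE /= -!addrA.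
  by congr (_ *: _ + (_ *: _ + (_ *: _ + (_ *: _ + (_ *: _ + _ *: _)))));
    congr (coord X _ v); apply: val_inj.
have uniqE a b c a' b' c' : a *j x + b *j y + c *j z = a' *j x + b' *j y + c' *j z ->
    [/\ a = a', b = b' & c = c'].
  move=> E; have [] := xyz (a - a') (b - b') (c - c').
    by rewrite !cscaleDl !cscaleNl (addrACA (a *j x)) (addrACA (_ + _)) E -!opprD subrr.
  by move=> /eqP Ha /eqP Hb /eqP Hc; split; apply/eqP; rewrite -subr_eq0.
have coD v w : [/\ co i0 i1 (v + w) = co i0 i1 v + co i0 i1 w,
     co i2 i3 (v + w) = co i2 i3 v + co i2 i3 w &
     co i4 i5 (v + w) = co i4 i5 v + co i4 i5 w].
  by split; rewrite /co !linearD.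
have coZ a v : [/\ co i0 i1 (a *j v) = a * co i0 i1 v,
     co i2 i3 (a *j v) = a * co i2 i3 v &
     co i4 i5 (a *j v) = a * co i4 i5 v].
  by apply: uniqE; rewrite -vE -!cscaleA -!cscaleDr -vE.
have coE a b c : [/\ co i0 i1 (a *j x + b *j y + c *j z) = a,
     co i2 i3 (a *j x + b *j y + c *j z) = b &
     co i4 i5 (a *j x + b *j y + c *j z) = c].
  by apply: uniqE; rewrite -vE.
have L0 : Clinear (co i0 i1) by split=> r s; [case: (coD r s)|case: (coZ r s)].
have L1 : Clinear (co i2 i3) by split=> r s; [case: (coD r s)|case: (coZ r s)].
have L2 : Clinear (co i4 i5) by split=> r s; [case: (coD r s)|case: (coZ r s)].
have Ex : x = 1 *j x + 0 *j y + 0 *j z by rewrite !cscale0r cscale1r !addr0.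
have Ey : y = 0 *j x + 1 *j y + 0 *j z by rewrite !cscale0r cscale1r add0r addr0.
have Ez : z = 0 *j x + 0 *j y + 1 *j z by rewrite !cscale0r cscale1r !add0r.
have [x1 x2 x3] := coE 1 0 0; have [y1 y2 y3] := coE 0 1 0.
have [z1 z2 z3] := coE 0 0 1; rewrite -Ex in x1 x2 x3; rewrite -Ey in y1 y2 y3.
rewrite -Ez in z1 z2 z3.
by exists (CFrame L0 L1 L2 vE (And3 x1 y1 z1) (And3 x2 y2 z2) (And3 x3 y3 z3)).
Qed.

End ComplexScalars.

(** * Complex volume forms *)
Lemma det3 (T : comPzRingType) (f : nat -> nat -> T) :
  \det (\matrix_(i < 3, j < 3) f i j) =
    f 0%N 0%N * (f 1%N 1%N * f 2%N 2%N - f 1%N 2%N * f 2%N 1%N)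
    - f 0%N 1%N * (f 1%N 0%N * f 2%N 2%N - f 1%N 2%N * f 2%N 0%N)
    + f 0%N 2%N * (f 1%N 0%N * f 2%N 1%N - f 1%N 1%N * f 2%N 0%N).
Proof.
do ![rewrite (expand_det_row _ ord0) !big_ord_recl !big_ord0 /cofactor ?det_mx11].
by rewrite !mxE /= /bump /=; ring.
Qed.

Section HolomorphicVolume.
Variables (R : realType) (V : vectType R) (J : 'End(V)).
Hypothesis JJ : forall x, J (J x) = - x.
Local Notation "a *j x" := (cscale J a x) (at level 40).

Lemma type10_Clinear (eta : {linear V -> Rcomplex R}) :
  type10 J eta -> Clinear J (eta : V -> R[i]).
Proof.
move=> etaJ; split=> [x y|a x]; first exact: linearD.
rewrite cscaleE linearD !linearZ /= etaJ; case: a (eta x) => [a a'] [b b'].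
apply/eqP; rewrite eq_complex /=; apply/andP; split; apply/eqP; ring.
Qed.

Lemma wedge3E (eta : 'I_3 -> {linear V -> Rcomplex R}) x y z :
  let p := (eta ord0 : V -> R[i]) in let q := (eta (inord 1) : V -> R[i]) in
  let r := (eta (inord 2) : V -> R[i]) in
  wedge3 eta x y z = p x * (q y * r z - q z * r y) - p y * (q x * r z - q z * r x)
   + p z * (q x * r y - q y * r x).
Proof.
pose f i j := (eta (inord i) (nth 0 [:: x; y; z] j) : R[i]).
have -> : wedge3 eta x y z = \det (\matrix_(i < 3, j < 3) f i j).
  by congr (\det _); apply/matrixP => i j; rewrite !mxE (tnth_nth 0) /f inord_val.
have e0 : inord 0 = ord0 :> 'I_3 by apply: val_inj; rewrite /= inordK.
by rewrite det3 /f /= e0; ring.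
Qed.

(** An alternating complex 3-form on (V, J).  Linearity in the other two
    slots follows from the symmetries. *)
Definition Cvolume (psi : V -> V -> V -> R[i]) :=
  [/\ forall y z, Clinear J (fun x => psi x y z),
      forall x y z, psi y x z = - psi x y z &
      forall x y z, psi x z y = - psi x y z].

Lemma type30_Cvolume psi : type30 J psi -> Cvolume psi.
Proof.
move=> [n [eta [etaJ psiE]]]; split.
- move=> y z; split=> [x x'|a x]; rewrite !psiE.
    rewrite -big_split; apply: eq_bigr => k _; rewrite !wedge3E /= !linearD /=.
    ring.
  rewrite mulr_sumr; apply: eq_bigr => k _; rewrite !wedge3E /=.
  rewrite !(ClinZ (type10_Clinear (etaJ _ _))).
  ring.
- move=> x y z; rewrite !psiE -sumrN; apply: eq_bigr => k _; rewrite !wedge3E /=.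
  ring.
- move=> x y z; rewrite !psiE -sumrN; apply: eq_bigr => k _; rewrite !wedge3E /=.
  ring.
Qed.

End HolomorphicVolume.

(** * The (0,1)-subalgebra and its traces *)
(** The action of the (0,1)-vector x + i J x on g_C modulo the
    (0,1)-vectors, a quotient identified with (V, J). *)
HB.lock Definition rho (R : realType) (V : vectType R) (L : lieBracket V)
  (J : 'End(V)) (x y : V) : V := L x y + J (L (J x) y).

(** The bracket of (0,1)-vectors: if X = x + i J x and Y = y + i J y, then
    [X, Y] = m + i J m with m = mu x y. *)
HB.lock Definition mu (R : realType) (V : vectType R) (L : lieBracket V)
  (J : 'End(V)) (x y : V) : V := L x y - L (J x) (J y).

Section FrameTrace.
Variables (R : realType) (V : vectType R) (J : 'End(V)).
Hypothesis JJ : forall x, J (J x) = - x.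
Local Notation "a *j x" := (cscale J a x) (at level 40).

Lemma Clinear_Re c : Clinear J c -> exists phi : {scalar V}, forall v, phi v = complex.Re (c v).
Proof.
move=> cL.
have lin : scalar (fun v => complex.Re (c v)).
  move=> a x y; rewrite (ClinD cL) (ClinR cL).
  by case: (c x) (c y) => [p q] [r s] /=; rewrite mul0r subr0.
pose h := GRing.isLinear.Build R V R *%R (fun v => complex.Re (c v)) lin.
pose p : {scalar V} := HB.pack (fun v => complex.Re (c v)) h.
by exists p.
Qed.

Lemma Clinear_Im c : Clinear J c -> exists phi : {scalar V}, forall v, phi v = complex.Im (c v).
Proof.
move=> cL.
have lin : scalar (fun v => complex.Im (c v)).
  move=> a x y; rewrite (ClinD cL) (ClinR cL).
  by case: (c x) (c y) => [p q] [r s] /=; rewrite mul0r addr0.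
pose h := GRing.isLinear.Build R V R *%R (fun v => complex.Im (c v)) lin.
pose p : {scalar V} := HB.pack (fun v => complex.Im (c v)) h.
by exists p.
Qed.

Definition frame_trace (F : cframe J) (f : V -> V) : R[i] :=
  co0 F (f (fr0 F)) + co1 F (f (fr1 F)) + co2 F (f (fr2 F)).

Lemma lfun_trace_frame (F : cframe J) (f : 'End(V)) : (forall v, f (J v) = J (f v)) ->
  lfun_trace f = 2 * complex.Re (frame_trace F f).
Proof.
move=> fJ.
have [r0 r0E] := Clinear_Re (co0L F); have [s0 s0E] := Clinear_Im (co0L F).
have [r1 r1E] := Clinear_Re (co1L F); have [s1 s1E] := Clinear_Im (co1L F).
have [r2 r2E] := Clinear_Re (co2L F); have [s2 s2E] := Clinear_Im (co2L F).
pose phi (i : 'I_6) : {scalar V} := nth r0 [:: r0; s0; r1; s1; r2; s2] i \o f.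
pose X (i : 'I_6) := nth 0 [:: fr0 F; J (fr0 F); fr1 F; J (fr1 F); fr2 F; J (fr2 F)] i.
rewrite (lfun_trace_sum (phi := phi) (X := X)).
  rewrite !big_ord_recr big_ord0 /= /phi /X /= !(r0E, s0E, r1E, s1E, r2E, s2E).
  rewrite !fJ !(ClinJ (co0L F), ClinJ (co1L F), ClinJ (co2L F)) /frame_trace.
  case: (co0 F _) (co1 F _) (co2 F _) => [a a'] [b b'] [c c'] /=; ring.
move=> v; rewrite {1}(frameE F (f v)) !cscaleE !big_ord_recr big_ord0 /= /phi /X /=.
by rewrite !(r0E, s0E, r1E, s1E, r2E, s2E) add0r !addrA.
Qed.

(** The traces of f and of J f determine the real and the imaginary part of
    the complex trace. *)
Lemma frame_trace_eq0 (F : cframe J) (f : 'End(V)) : (forall v, f (J v) = J (f v)) ->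
  lfun_trace f = 0 -> lfun_trace (J \o f)%VF = 0 -> frame_trace F f = 0.
Proof.
move=> fJ t1 t2; rewrite (lfun_trace_frame F fJ) in t1.
have JfJ v : (J \o f)%VF (J v) = J ((J \o f)%VF v) by rewrite !comp_lfunE fJ.
rewrite (lfun_trace_frame F JfJ) /frame_trace !comp_lfunE in t2.
rewrite !(ClinJ (co0L F), ClinJ (co1L F), ClinJ (co2L F)) in t2.
move: t1 t2; rewrite /frame_trace.
case: (co0 F _) (co1 F _) (co2 F _) => [a a'] [b b'] [c c'] /= t1 t2.
by apply/eqP; rewrite eq_complex /=; apply/andP; split; apply/eqP; lra.
Qed.

Lemma frame_trace_J (F : cframe J) (f : 'End(V)) : (forall v, f (J v) = J (f v)) ->
  frame_trace F f = 0 -> lfun_trace (J \o f)%VF = 0.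
Proof.
move=> fJ t1.
have JfJ v : (J \o f)%VF (J v) = J ((J \o f)%VF v) by rewrite !comp_lfunE fJ.
rewrite (lfun_trace_frame F JfJ) /frame_trace !comp_lfunE.
rewrite !(ClinJ (co0L F), ClinJ (co1L F), ClinJ (co2L F)).
by rewrite -!mulrDr -/(frame_trace F f) t1 mulr0 mulr0.
Qed.

(** A volume form is an eigenvector of the derivation induced by f, with the
    trace of f as eigenvalue.  Only the complex multilinearity of [psi] is used,
    so f is an arbitrary map. *)
Lemma Cvolume_trace psi (F : cframe J) (f : V -> V) : Cvolume J psi ->
  let e0 := fr0 F in let e1 := fr1 F in let e2 := fr2 F in
  psi (f e0) e1 e2 + psi e0 (f e1) e2 + psi e0 e1 (f e2) =
    frame_trace F f * psi e0 e1 e2.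
Proof.
move=> [psiL psi12 psi23] /=.
have psi31 x y z : psi z x y = psi x y z by rewrite psi12 psi23 opprK.
have psi0 a b : psi a a b = 0 by apply: eq_opp_eq0; exact: psi12.
have psiE x y z v : psi (x *j fr0 F + y *j fr1 F + z *j fr2 F) v =1 fun w =>
    x * psi (fr0 F) v w + y * psi (fr1 F) v w + z * psi (fr2 F) v w.
  by move=> w; rewrite !(ClinE (psiL v w)).
have psi1 u v w : psi u v w = co0 F u * psi (fr0 F) v w + co1 F u * psi (fr1 F) v w
    + co2 F u * psi (fr2 F) v w by rewrite {1}(frameE F u) psiE.
rewrite (psi1 (f (fr0 F))) (psi12 (f (fr1 F)) (fr0 F)) (psi1 (f (fr1 F))).
rewrite -(psi31 (fr0 F) (fr1 F) (f (fr2 F))) (psi1 (f (fr2 F))) !psi0.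
have psi0' a b : psi a b a = 0 by rewrite psi23 psi0 oppr0.
rewrite !psi0' (psi12 (fr0 F) (fr1 F)) (psi31 (fr0 F) (fr1 F)) /frame_trace.
ring.
Qed.

(** All values of an alternating 3-form in dimension 3 are multiples of its
    value on a basis. *)
Lemma Cvolume_neq0 psi (F : cframe J) x y z : Cvolume J psi ->
  psi x y z != 0 -> psi (fr0 F) (fr1 F) (fr2 F) != 0.
Proof.
move=> [psiL psi12 psi23]; apply: contraNneq => psi_e0.
have psi31 u v w : psi w u v = psi u v w by rewrite psi12 psi23 opprK.
have psi0 a b : psi a a b = 0 by apply: eq_opp_eq0; exact: psi12.
have psi0' a b : psi a b a = 0 by rewrite psi23 psi0 oppr0.
have psi0'' a b : psi b a a = 0 by rewrite psi31 psi0.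
have psi1 u v w : psi u v w = co0 F u * psi (fr0 F) v w + co1 F u * psi (fr1 F) v w
    + co2 F u * psi (fr2 F) v w by rewrite {1}(frameE F u) !(ClinE (psiL v w)).
have psi2 u v w : psi u v w = co0 F v * psi u (fr0 F) w + co1 F v * psi u (fr1 F) w
    + co2 F v * psi u (fr2 F) w.
  by rewrite psi12 psi1 (psi12 u (fr0 F)) (psi12 u (fr1 F)) (psi12 u (fr2 F)); ring.
have psi3 u v w : psi u v w = co0 F w * psi u v (fr0 F) + co1 F w * psi u v (fr1 F)
    + co2 F w * psi u v (fr2 F).
  by rewrite psi23 psi2 (psi23 u (fr0 F)) (psi23 u (fr1 F)) (psi23 u (fr2 F)); ring.
move: psi_e0 psi1 psi2 psi3; move: (fr0 F) (fr1 F) (fr2 F) => e0 e1 e2.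
move=> psi_e0 psi1 psi2 psi3.
have p1 : psi e1 e2 e0 = 0 by rewrite -psi31.
have p2 : psi e2 e0 e1 = 0 by rewrite psi31.
have q0 : psi e1 e0 e2 = 0 by rewrite psi12 psi_e0 oppr0.
have q1 : psi e0 e2 e1 = 0 by rewrite psi23 psi_e0 oppr0.
have q2 : psi e2 e1 e0 = 0 by rewrite psi23 p2 oppr0.
rewrite psi1 (psi2 e0) (psi2 e1) (psi2 e2) !(psi3 _ _ z).
rewrite psi_e0 p1 p2 q0 q1 q2 !psi0 !psi0' !psi0''.
by apply/eqP; ring.
Qed.

End FrameTrace.

Section ComplexStructure.
Variables (R : realType) (V : vectType R) (L : lieBracket V) (J : 'End(V)).
Hypothesis JJ : forall x, J (J x) = - x.
Hypothesis nij0 : forall x y, nijenhuis L J x y = 0.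
Local Notation "a *j x" := (cscale J a x) (at level 40).
Local Notation rho := (rho L J).
Local Notation mu := (mu L J).

Lemma rhoE x y : rho x y = L x y + J (L (J x) y).
Proof. by rewrite unlock. Qed.
Lemma muE x y : mu x y = L x y - L (J x) (J y).
Proof. by rewrite unlock. Qed.

Lemma nijE x y : L (J x) (J y) = L x y + J (L (J x) y) + J (L x (J y)).
Proof. by apply/eqP; rewrite eq_sym -subr_eq0; apply/eqP; exact: nij0. Qed.

Lemma J_mu x y : J (mu x y) = L (J x) y + L x (J y).
Proof. by rewrite muE nijE !lfE !JJ; vring. Qed.

Lemma br_rho_mu x y : 2 *: L x y = rho x y - rho y x + mu x y.
Proof.
rewrite !rhoE muE nijE (brC L y x) (brC L (J y) x) linearN.
by vring.
Qed.

Lemma rhoJr x y : rho x (J y) = J (rho x y).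
Proof. by rewrite !rhoE nijE !lfE !JJ; vring. Qed.

Lemma rhoJl x y : rho (J x) y = - J (rho x y).
Proof. by rewrite !rhoE JJ !brE !lfE !JJ; vring. Qed.

Lemma rhoDr x y z : rho x (y + z) = rho x y + rho x z.
Proof. by rewrite !rhoE !brE !lfE; vring. Qed.
Lemma rhoDl x y z : rho (x + y) z = rho x z + rho y z.
Proof. by rewrite !rhoE !lfE !brE linearE /=; vring. Qed.
Lemma rhoZr a x y : rho x (a *j y) = a *j rho x y.
Proof.
by rewrite !cscaleE rhoDr -rhoJr !rhoE !brE !lfE; vring.
Qed.
Lemma rhoZl (a : R[i]) x y : rho (a *j x) y = (a^*)%C *j rho x y.
Proof.
case: a => a b; rewrite !cscaleE /= rhoDl.
have E r u v : rho (r *: u) v = r *: rho u v.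
  by rewrite !rhoE linearZ /= !brE linearZ scalerDr.
by rewrite !E rhoJl scaleNr scalerN.
Qed.

(** The quotient of the adjoint representation by the subalgebra is a
    representation. *)
Lemma rho_mu x y z : rho (mu x y) z = rho x (rho y z) - rho y (rho x z).
Proof.
have E u v : rho u (rho v z) =
    L u (L v z) + J (L (J u) (L v z)) + J (L u (L (J v) z)) - L (J u) (L (J v) z).
  by rewrite !rhoE !brE nijE !lfE !JJ; vring.
rewrite !E rhoE J_mu muE !brE !lfE !(jacobi_br L); vring.
Qed.

Lemma muDr x y z : mu x (y + z) = mu x y + mu x z.
Proof. by rewrite !muE !lfE !brE; vring. Qed.
Lemma muJr x y : mu x (J y) = J (mu x y).
Proof. by rewrite J_mu muE JJ !brE; vring. Qed.
Lemma muC x y : mu x y = - mu y x.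
Proof. by rewrite !muE (brC L x) (brC L (J x)); vring. Qed.
Lemma muZr a x y : mu x (a *j y) = a *j mu x y.
Proof.
have E r u v : mu u (r *: v) = r *: mu u v.
  by rewrite !muE linearZ /= !brE scalerBr.
by rewrite !cscaleE muDr !E muJr.
Qed.
Lemma muDl x y z : mu (x + y) z = mu x z + mu y z.
Proof. by rewrite ![mu _ z]muC muDr opprD. Qed.
Lemma muZl a x y : mu (a *j x) y = a *j mu x y.
Proof. by rewrite !(muC _ y) muZr cscaleNr. Qed.

Section Traces.
Hypothesis dimV : \dim {:V} = 6%N.
Hypothesis uni : unimodular L.

Definition rho_lfun x : 'End(V) := (ad L x + (J \o ad L (J x)))%VF.
Lemma rho_lfunE x y : rho_lfun x y = rho x y.
Proof. by rewrite rhoE /rho_lfun lfunE /= lfunE /= !adE. Qed.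

(** Closedness, tested on X = x + i J x and a complex basis, says that rho x
    is traceless: the terms of d psi in which X is left as an argument of psi
    vanish, because psi (X, ., .) = 0.  Up to a factor, the imaginary part of
    the trace of rho x is tr (J ad x) - tr (ad (J x)), and tr (ad (J x)) = 0. *)
Lemma trace_J_ad x : has_nonzero_closed_30_form L J -> lfun_trace (J \o ad L x)%VF = 0.
Proof.
case=> psi [/type30_Cvolume vol closed [a [b [c psi_neq0]]]].
have [F _] : exists F : cframe J, True.
  have a0 : a != 0.
    apply: contraNneq psi_neq0 => ->; case: vol => psiL _ _.
    by rewrite (Clin0 (psiL b c)).
  have [b' /cindep3_ext] := cindep2_ext JJ dimV a0.
  by case/(_ JJ dimV) => c' /(cframe_of JJ dimV)[F _]; exists F.
have psiF := Cvolume_neq0 F vol psi_neq0.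
have tr0 : frame_trace F (rho_lfun x) = 0.
  have := Cvolume_trace F (rho_lfun x) vol; set e0 := fr0 F; set e1 := fr1 F.
  set e2 := fr2 F => /= E; apply/eqP; have := mulf_eq0 (frame_trace F (rho_lfun x)) (psi e0 e1 e2).
  rewrite (negPf psiF) orbF => <-; rewrite -E !rho_lfunE !rhoE.
  move: (closed x e0 e1 e2) (closed (J x) e0 e1 e2); rewrite /d3.
  case: vol => psiL psi12 psi23.
  have psi31 u v w : psi u v w = psi w u v by rewrite [RHS]psi12 [psi u w v]psi23 opprK.
  rewrite ![psi _ (J x) _]psi12 !(ClinJ (psiL _ _)) ![psi _ x _]psi12.
  rewrite (psi12 (L x e1 + _)) (psi31 e0 e1) !(ClinE (psiL _ _)).
  move: ('i%C) (sqr_i R) => I I2 h h'.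
  (* T collects the terms with X as an argument; they enter with the factor
     1 + i^2. *)
  pose T := psi x (L e0 e1) e2 - psi x (L e0 e2) e1 + psi x (L e1 e2) e0.
  match type of h with ?l = _ => match type of h' with ?l' = _ =>
    transitivity ((I ^+ 2 + 1) * T - (l + I * l') == 0) end end.
    by congr (_ == _); rewrite /T; ring.
  by rewrite h h' I2 addNr mulr0 mul0r addr0 subrr eqxx.
have fJ v : rho_lfun x (J v) = J (rho_lfun x v) by rewrite !rho_lfunE rhoJr.
have := frame_trace_J fJ tr0; rewrite /rho_lfun.
have -> : (J \o (ad L x + (J \o ad L (J x))) = (J \o ad L x) - ad L (J x))%VF.
  by apply/lfunP => v; rewrite !(comp_lfunE, add_lfunE, opp_lfunE, adE) !lfE JJ.
by rewrite lfun_traceD lfun_traceN uni subr0.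
Qed.

Definition mu_lfun x : 'End(V) := (ad L x - (ad L (J x) \o J))%VF.
Lemma mu_lfunE x y : mu_lfun x y = mu x y.
Proof. by rewrite muE /mu_lfun add_lfunE opp_lfunE comp_lfunE !adE. Qed.

Hypothesis trJ : forall x, lfun_trace (J \o ad L x)%VF = 0.

Lemma rho_trace (F : cframe J) x : frame_trace F (rho x) = 0.
Proof.
suff : frame_trace F (rho_lfun x) = 0 by rewrite /frame_trace !rho_lfunE.
apply: frame_trace_eq0 => [v||]; first by rewrite !rho_lfunE rhoJr.
  by rewrite /rho_lfun lfun_traceD uni trJ addr0.
have -> : (J \o rho_lfun x = (J \o ad L x) - ad L (J x))%VF.
  rewrite /rho_lfun; apply/lfunP => v.
  by rewrite !(comp_lfunE, add_lfunE, opp_lfunE, adE) !lfE JJ.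
by rewrite lfun_traceD lfun_traceN uni trJ subr0.
Qed.

Lemma mu_trace (F : cframe J) x : frame_trace F (mu x) = 0.
Proof.
suff : frame_trace F (mu_lfun x) = 0 by rewrite /frame_trace !mu_lfunE.
apply: frame_trace_eq0 => [v||]; first by rewrite !mu_lfunE muJr.
  by rewrite /mu_lfun lfun_traceD lfun_traceN uni lfun_traceC trJ subrr.
have -> : (J \o mu_lfun x = (J \o ad L x) - ((J \o ad L (J x)) \o J))%VF.
  rewrite /mu_lfun; apply/lfunP => v.
  by rewrite !(comp_lfunE, add_lfunE, opp_lfunE, adE) !lfE.
rewrite lfun_traceD lfun_traceN trJ lfun_traceC.
have -> : (J \o (J \o ad L (J x)) = - ad L (J x))%VF.
  by apply/lfunP => v; rewrite !(comp_lfunE, opp_lfunE, adE) JJ.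
by rewrite lfun_traceN uni oppr0 subrr.
Qed.

End Traces.
End ComplexStructure.

(** * A central vector outside the derived algebra *)
Section CentralFactor.
Variables (R : realType) (V : vectType R) (L : lieBracket V) (J : 'End(V)).
Hypothesis JJ : forall x, J (J x) = - x.
Hypothesis nij0 : forall x y, nijenhuis L J x y = 0.
Hypothesis dimV : \dim {:V} = 6%N.
Hypothesis uni : unimodular L.
Hypothesis trJ : forall x, lfun_trace (J \o ad L x)%VF = 0.
Variables (z : V) (zeta : {scalar V}).
Hypothesis z_central : forall x, L z x = 0.
Hypothesis zeta_z : zeta z = 1.
Hypothesis zeta_br : forall x y, zeta (L x y) = 0.
Local Notation "a *j x" := (cscale J a x) (at level 40).
Local Notation rho := (rho L J).
Local Notation mu := (mu L J).
Local Notation D := (L (J z)).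

(** The complex linear form with real part [zeta]; its kernel is the complex
    plane W. *)
Definition zetaC x : R[i] := (zeta x -i* zeta (J x))%C.

Lemma zetaC_lin : Clinear J zetaC.
Proof.
split=> [x y|a x]; rewrite /zetaC.
  by rewrite lfD !scD opprD.
rewrite cscaleE !lfE JJ !scE; case: a => a b.
by apply/eqP; rewrite eq_complex /=; apply/andP; split; apply/eqP; ring.
Qed.

Lemma zetaC_eq0 x : zetaC x = 0 -> zeta x = 0 /\ zeta (J x) = 0.
Proof. by rewrite /zetaC; case=> -> /eqP; rewrite oppr_eq0 => /eqP ->. Qed.

Lemma zetaC0 x : zeta x = 0 -> zeta (J x) = 0 -> zetaC x = 0.
Proof. by rewrite /zetaC => -> ->; rewrite oppr0. Qed.

Lemma zetaC_z : zetaC z != 0.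
Proof. by apply/eqP => /zetaC_eq0[/eqP]; rewrite zeta_z oner_eq0. Qed.

Lemma zr_central x : L x z = 0.
Proof. by rewrite brC z_central oppr0. Qed.

Lemma zetaC_mu x y : zetaC (mu x y) = 0.
Proof.
apply: zetaC0; first by rewrite muE !scE !zeta_br subrr.
by rewrite J_mu // scD !zeta_br addr0.
Qed.

Lemma D_J y : D (J y) = J (D y).
Proof.
have := nijE nij0 z y; rewrite !z_central lf0 addr0 add0r => ->; by [].
Qed.

Lemma D_cs a y : D (a *j y) = a *j D y.
Proof. by rewrite !cscaleE !brE D_J. Qed.

Lemma D_z : D z = 0. Proof. exact: zr_central. Qed.

Lemma zetaC_D y : zetaC (D y) = 0.
Proof. by apply: zetaC0; rewrite ?zeta_br // -D_J zeta_br. Qed.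

Lemma rho_z x : rho x z = 0.
Proof. by rewrite rhoE !zr_central lf0 addr0. Qed.

(** A frame (z, u, v) whose last two vectors span W over the complex
    numbers. *)
Definition adapted (F : cframe J) :=
  [/\ fr0 F = z, zetaC (fr1 F) = 0 & zetaC (fr2 F) = 0].

Lemma adapted_exists2 u v : zetaC u = 0 -> zetaC v = 0 -> cindep2 J u v ->
  exists F, [/\ adapted F, fr1 F = u & fr2 F = v].
Proof.
move=> zu zv uv; have [|F [F0 F1 F2]] := @cframe_of _ _ _ JJ dimV z u v.
  move=> a b c abc; have a0 : a = 0.
    have := congr1 zetaC abc; rewrite !(ClinE zetaC_lin) zu zv !mulr0 !addr0.
    by move/eqP; rewrite mulf_eq0 (negPf zetaC_z) orbF => /eqP.
  by move: abc; rewrite a0 cscale0r add0r => /uv[].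
by exists F; split; rewrite ?F1 ?F2 // /adapted F0 F1 F2.
Qed.

Lemma adapted_exists u : zetaC u = 0 -> u != 0 -> exists F, adapted F /\ fr1 F = u.
Proof.
move=> zu u0; have zu2 : cindep2 J z u.
  move=> a b ab; have a0 : a = 0.
    have := congr1 zetaC ab; rewrite !(ClinE zetaC_lin) zu !mulr0 !addr0.
    by move/eqP; rewrite mulf_eq0 (negPf zetaC_z) orbF => /eqP.
  move: ab; rewrite a0 cscale0r add0r => /(cscale_eq0 JJ)[//|u00].
  by rewrite u00 eqxx in u0.
have [v' zuv] := cindep3_ext JJ dimV zu2.
pose k := - (zetaC v' / zetaC z); pose v := v' + k *j z.
have [||F [aF F1 _]] := @adapted_exists2 u v zu; last by exists F.
  by rewrite /v /k !(ClinE zetaC_lin) mulNr divfK ?zetaC_z // subrr.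
move=> a b; rewrite /v cscaleDr cscaleA // addrA addrC addrA => /zuv[] //.
Qed.

Lemma adapted_exists0 : exists F, adapted F.
Proof.
have zn0 : z != 0.
  by apply/eqP => z0; move: zeta_z; rewrite z0 sc0 => /eqP; rewrite eq_sym oner_eq0.
have [u' zu] := cindep2_ext JJ dimV zn0.
pose k := - (zetaC u' / zetaC z); pose u := u' + k *j z.
have [||F [aF _]] := @adapted_exists u; last by exists F.
  by rewrite /u /k !(ClinE zetaC_lin) mulNr divfK ?zetaC_z // subrr.
apply/eqP => u0; have := zu k 1; rewrite cscale1r addrC -/u u0 => /(_ erefl)[_ /eqP].
by rewrite oner_eq0.
Qed.

Section Adapted.
Variables (F : cframe J) (aF : adapted F).
Local Notation u := (fr1 F).
Local Notation v := (fr2 F).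
Local Notation c1 := (co1 F).
Local Notation c2 := (co2 F).

Lemma co0_zetaC x : zetaC x = 0 -> co0 F x = 0.
Proof.
case: aF => F0 F1 F2; rewrite {1}(frameE F x) !(ClinE zetaC_lin) F0 F1 F2.
by rewrite !mulr0 !addr0 => /eqP; rewrite mulf_eq0 (negPf zetaC_z) orbF => /eqP.
Qed.

Lemma frameW x : zetaC x = 0 -> x = c1 x *j u + c2 x *j v.
Proof. by move/co0_zetaC => x0; rewrite {1}(frameE F x) x0 cscale0r add0r. Qed.

Lemma c1E : [/\ c1 z = 0, c1 u = 1 & c1 v = 0].
Proof. by case: aF => <- _ _; exact: co1E. Qed.
Lemma c2E : [/\ c2 z = 0, c2 u = 0 & c2 v = 1].
Proof. by case: aF => <- _ _; exact: co2E. Qed.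
Lemma zetaCu : zetaC u = 0. Proof. by case: aF. Qed.
Lemma zetaCv : zetaC v = 0. Proof. by case: aF. Qed.

Lemma mu_xx x : mu x x = 0.
Proof.
by apply: scalar_ext => f; have := congr1 f (muC L J x x); rewrite !scE; lra.
Qed.

(** Unimodularity of h.  All brackets of h lie in W by [zetaC_mu], so the
    traces of mu u and mu v are the v- and the u-coordinate of mu u v, up to sign. *)
Lemma mu_uv : mu u v = 0.
Proof.
have F0 : fr0 F = z by case: aF.
have := mu_trace JJ nij0 uni trJ F u; have := mu_trace JJ nij0 uni trJ F v.
rewrite /frame_trace !co0_zetaC ?zetaC_mu // !mu_xx !(Clin0 (co1L F), Clin0 (co2L F)).
rewrite !add0r addr0 (muC L J v) (ClinN (co1L F)) => /eqP.
rewrite oppr_eq0 => /eqP m1 m2.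
by rewrite (frameW (zetaC_mu u v)) m1 m2 !cscale0r addr0.
Qed.
End Adapted.

Lemma mu_W x y : zetaC x = 0 -> zetaC y = 0 -> mu x y = 0.
Proof.
have [F aF] := adapted_exists0 => x0 y0.
rewrite (frameW aF x0) (frameW aF y0) !(muDr, muDl) !(muZl, muZr) //.
rewrite !mu_xx mu_uv // (muC L J (fr2 F)) mu_uv // oppr0 !cscaler0.
by rewrite !addr0.
Qed.

Lemma rho_comm x y t : zetaC x = 0 -> zetaC y = 0 ->
  rho x (rho y t) = rho y (rho x t).
Proof.
move=> x0 y0; apply/eqP; rewrite -subr_eq0 -rho_mu //.
by rewrite mu_W // rhoE (lf0 J) !br0l lf0 addr0.
Qed.

Lemma br_W x y : zetaC x = 0 -> zetaC y = 0 -> 2 *: L x y = rho x y - rho y x.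
Proof. by move=> x0 y0; rewrite (br_rho_mu nij0) // mu_W // addr0. Qed.

(** This is [rho_mu] for (z, y), since rho z = J D and mu z y = - J D y. *)
Lemma rho_D y x : rho (D y) x = D (rho y x) - rho y (D x).
Proof.
rewrite !rhoE -D_J !brE !(jacobi_br L (J z)) (D_J (L (J y) x)) !lfE.
vring.
Qed.

Lemma rho_co (F : cframe J) (c : V -> R[i]) x y : adapted F -> Clinear J c ->
  c (rho x y) = co1 F y * c (rho x (fr1 F)) + co2 F y * c (rho x (fr2 F)).
Proof.
move=> [F0 _ _] cL; rewrite {1}(frameE F y) F0 !rhoDr !rhoZr // rho_z.
by rewrite !(ClinE cL) mulr0 add0r.
Qed.

Lemma rho_trace_co (F : cframe J) x : adapted F ->
  co2 F (rho x (fr2 F)) = - co1 F (rho x (fr1 F)).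
Proof.
move=> [F0 _ _]; have := rho_trace JJ nij0 uni trJ F x.
rewrite /frame_trace F0 rho_z (Clin0 (co0L F)) add0r => /eqP.
by rewrite addrC addr_eq0 => /eqP.
Qed.

(** Traceless 2 x 2 matrices commute exactly if their coefficient vectors in
    C^3 have zero cross product. *)
Lemma commuting_traceless_dependent (p1 p2 p3 q1 q2 q3 : R[i]) :
  p1 * q2 = p2 * q1 -> p1 * q3 = p3 * q1 -> p2 * q3 = p3 * q2 ->
  exists a b, [/\ a * p1 + b * q1 = 0, a * p2 + b * q2 = 0, a * p3 + b * q3 = 0 &
    (a != 0) || (b != 0)].
Proof.
move=> e12 e13 e23.
case: (eqVneq p1 0) => [p10|p1n]; last first.
  exists q1, (- p1); rewrite oppr_eq0 p1n orbT !mulNr e12 e13; split=> //; ring.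
case: (eqVneq p2 0) => [p20|p2n]; last first.
  exists q2, (- p2); rewrite oppr_eq0 p2n orbT !mulNr e23 -e12; split=> //; ring.
case: (eqVneq p3 0) => [p30|p3n]; last first.
  exists q3, (- p3); rewrite oppr_eq0 p3n orbT !mulNr -e23 -e13; split=> //; ring.
by exists 1, 0; rewrite p10 p20 p30 !mulr0 !mul0r addr0 oner_eq0.
Qed.

(** The map x |-> rho x on W is antilinear with values in pairwise commuting
    traceless 2 x 2 matrices modulo z, so it is not injective. *)
Lemma exists_rho_null : exists u, [/\ u != 0, zetaC u = 0 &
  forall c, Clinear J c -> c z = 0 -> forall y, c (rho u y) = 0].
Proof.
have [F aF] := adapted_exists0; set u := fr1 F; set v := fr2 F.
have u0 : zetaC u = 0 := zetaCu aF; have v0 : zetaC v = 0 := zetaCv aF.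
set p1 := co1 F (rho u u); set p2 := co2 F (rho u u); set p3 := co1 F (rho u v).
set q1 := co1 F (rho v u); set q2 := co2 F (rho v u); set q3 := co1 F (rho v v).
have p4 : co2 F (rho u v) = - p1 := rho_trace_co u aF.
have q4 : co2 F (rho v v) = - q1 := rho_trace_co v aF.
have com c w : Clinear J c -> c (rho u (rho v w)) = c (rho v (rho u w)).
  by move=> _; rewrite rho_comm.
have c1L := co1L F; have c2L := co2L F.
have e1 : p2 * q3 = p3 * q2.
  have := com _ u c1L; rewrite (rho_co u _ aF c1L) (rho_co v (rho u u) aF c1L).
  rewrite -/u -/v -/p1 -/p2 -/p3 -/q1 -/q2 -/q3 => /eqP; rewrite -subr_eq0 => /eqP E.
  by apply/eqP; rewrite -subr_eq0; apply/eqP; rewrite -oppr0 -E; ring.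
have e2 : p1 * q2 = p2 * q1.
  have := com _ u c2L; rewrite (rho_co u _ aF c2L) (rho_co v (rho u u) aF c2L).
  rewrite -/u -/v p4 q4 -/p1 -/p2 -/p3 -/q1 -/q2 -/q3 => /eqP; rewrite -subr_eq0 => /eqP E.
  by apply/eqP; rewrite -subr_eq0; apply/eqP/double_eq0; rewrite -oppr0 -E; ring.
have e3 : p1 * q3 = p3 * q1.
  have := com _ v c1L; rewrite (rho_co u _ aF c1L) (rho_co v (rho u v) aF c1L).
  rewrite -/u -/v p4 q4 -/p1 -/p2 -/p3 -/q1 -/q2 -/q3 => /eqP; rewrite -subr_eq0 => /eqP E.
  by apply/eqP; rewrite -subr_eq0; apply/eqP/double_eq0; rewrite -E; ring.
have [a [b [E1 E2 E3 ab]]] := commuting_traceless_dependent e2 e3 e1.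
have E4 : a * - p1 + b * - q1 = 0 by rewrite !mulrN -opprD E1 oppr0.
(* conjugate coefficients, because rho is antilinear in its first argument *)
exists ((a^*)%C *j u + (b^*)%C *j v); split.
- apply: contraTneq ab => uv0.
  have [_ cu cv] := c1E aF; have [_ du dv] := c2E aF.
  have := congr1 (co1 F) uv0; have := congr1 (co2 F) uv0.
  rewrite !(ClinE c1L) !(ClinE c2L) cu cv du dv !mulr0 !mulr1 addr0 add0r.
  by move=> /eqP; rewrite conjc_eq0 => /eqP-> /eqP; rewrite conjc_eq0 => /eqP->; rewrite eqxx.
- by rewrite !(ClinE zetaC_lin) u0 v0 !mulr0 addr0.
move=> c cL cz y; set u' := _ + _.
have main w : c (rho u' w) = a * c (rho u w) + b * c (rho v w).
  by rewrite rhoDl !rhoZl // !(ClinE cL) !conjcK.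
have ce t : c t = co1 F t * c u + co2 F t * c v.
  have F0 : fr0 F = z by case: aF.
  by rewrite {1}(frameE F t) !(ClinE cL) F0 cz mulr0 add0r.
rewrite (rho_co u' y aF cL) !main ![c (rho _ _)]ce p4 q4 -/u -/v -/p1 -/p2 -/p3 -/q1 -/q2 -/q3.
transitivity (co1 F y * ((a * p1 + b * q1) * c u + (a * p2 + b * q2) * c v) +
   co2 F y * ((a * p3 + b * q3) * c u + (a * - p1 + b * - q1) * c v)); first by ring.
by rewrite E1 E2 E3 E4 !mul0r addr0 !mulr0 addr0.
Qed.

Lemma D_co (F : cframe J) (c : V -> R[i]) y : adapted F -> Clinear J c ->
  c (D y) = co1 F y * c (D (fr1 F)) + co2 F y * c (D (fr2 F)).
Proof.
move=> [F0 _ _] cL; rewrite {1}(frameE F y) F0 !brDr !D_cs D_z.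
by rewrite !(ClinE cL) mulr0 add0r.
Qed.

Lemma D_trace (F : cframe J) : adapted F ->
  co2 F (D (fr2 F)) = - co1 F (D (fr1 F)).
Proof.
move=> [F0 _ _].
have := @frame_trace_eq0 _ _ _ F (ad L (J z)); rewrite /frame_trace !adE F0 D_z.
rewrite (Clin0 (co0L F)) add0r => E; apply/eqP; rewrite -addr_eq0 addrC; apply/eqP/E => //.
by move=> x; rewrite !adE D_J.
Qed.

(** The entries of rho (D y) = [D, rho y], where D = (a, b; d, - a) and
    rho v = (p, q; r, - p) in the frame (u, v) and rho u = 0.  If a <> 0, then
    conj a or - conj a would have to equal 2 a unless rho v = 0, but their moduli
    differ. *)
Lemma scalar_dichotomy (a b d p q r : R[i]) :
  (b^*)%C * p = 0 -> (b^*)%C * q = 0 -> (b^*)%C * r = 0 ->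
  - (a^*)%C * p = p * a + q * d - (a * p + b * r) ->
  - (a^*)%C * q = p * b - q * a - (a * q - b * p) ->
  - (a^*)%C * r = r * a - p * d - (d * p - a * r) ->
  [/\ p = 0, q = 0 & r = 0] \/ [/\ a = 0, b = 0, q * d = 0 & p * d = 0].
Proof.
move=> bp bq br e1 e2 e3.
have zeroM (x y : R[i]) : x * y = 0 -> x = 0 \/ y = 0.
  by move/eqP; rewrite mulf_eq0 => /orP[] /eqP; [left|right].
have conj0 (x : R[i]) : (x^*)%C = 0 -> x = 0 by move/eqP; rewrite conjc_eq0 => /eqP.
case: (eqVneq b 0) => [b0|bn0]; last first.
  by left; split; [case: (zeroM _ _ bp)|case: (zeroM _ _ bq)|case: (zeroM _ _ br)];
    move=> // /conj0 b0; rewrite b0 eqxx in bn0.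
have s1 (x : R[i]) : 2 * x = (x^*)%C -> x = 0.
  case: x => x y H; apply/eqP; rewrite eq_complex /=.
  have := congr1 (@complex.Re R) H; have := congr1 (@complex.Im R) H.
  by rewrite /= => h1 h2; apply/andP; split; apply/eqP; lra.
have s2 (x : R[i]) : 2 * x = - (x^*)%C -> x = 0.
  case: x => x y H; apply/eqP; rewrite eq_complex /=.
  have := congr1 (@complex.Re R) H; have := congr1 (@complex.Im R) H.
  by rewrite /= => h1 h2; apply/andP; split; apply/eqP; lra.
rewrite b0 !mul0r ?mulr0 in e1 e2 e3.
case: (eqVneq a 0) => [a0|an0].
  right; split=> //.
    by rewrite a0 conjc0 oppr0 mul0r in e1; rewrite [RHS]e1; ring.
  have : 2 * (p * d) = 0 by rewrite a0 conjc0 oppr0 !mul0r in e3; apply: oppr_inj; rewrite oppr0 [RHS]e3; ring.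
  by move/zeroM=> [/eqP|//]; rewrite pnatr_eq0.
have nz1 : 2 * a - (a^*)%C != 0 by apply: contraNneq an0 => /eqP; rewrite subr_eq0 => /eqP /s1->.
have nz2 : 2 * a + (a^*)%C != 0 by apply: contraNneq an0 => /eqP; rewrite addr_eq0 => /eqP /s2->.
have q0 : q = 0.
  have /zeroM[/eqP|//] : (2 * a - (a^*)%C) * q = 0; last by rewrite (negPf nz1).
  by rewrite mulrBl -mulNr e2; ring.
have p0 : p = 0.
  have /zeroM[|//] : (a^*)%C * p = 0; last by move/conj0 => a0; rewrite a0 eqxx in an0.
  by apply: oppr_inj; rewrite -mulNr e1 q0; ring.
have r0 : r = 0.
  have /zeroM[/eqP|//] : (2 * a + (a^*)%C) * r = 0; last by rewrite (negPf nz2).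
  by rewrite mulrDl -[X in _ + X]opprK -mulNr e3 p0; ring.
by left.
Qed.

Section NullFrame.
Variables (F : cframe J) (aF : adapted F).
Hypothesis rho_u : forall c, Clinear J c -> c z = 0 -> forall y, c (rho (fr1 F) y) = 0.
Local Notation u := (fr1 F).
Local Notation v := (fr2 F).
Let c1L := co1L F.
Let c2L := co2L F.
Let c1z : co1 F z = 0. Proof. by case: (c1E aF). Qed.
Let c2z : co2 F z = 0. Proof. by case: (c2E aF). Qed.

Lemma rho_null c x y : Clinear J c -> c z = 0 -> zetaC x = 0 ->
  c (rho x y) = (co2 F x)^*%C * c (rho v y).
Proof.
move=> cL cz x0; rewrite {1}(frameW aF x0) rhoDl !rhoZl // !(ClinE cL).
by rewrite rho_u // mulr0 add0r.
Qed.

Lemma br_coW c x y : Clinear J c -> c z = 0 -> zetaC x = 0 -> zetaC y = 0 ->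
  2 * c (L x y) =
    (co2 F x)^*%C * (co1 F y * c (rho v u) + co2 F y * c (rho v v)) -
    (co2 F y)^*%C * (co1 F x * c (rho v u) + co2 F x * c (rho v v)).
Proof.
move=> cL cz x0 y0.
have -> : 2 * c (L x y) = c (2 *: L x y) by rewrite (ClinR cL) rmorph_nat.
rewrite (br_W x0 y0) (ClinD cL) (ClinN cL) (rho_null _ cL cz x0) (rho_null _ cL cz y0).
by rewrite (rho_co v y aF cL) (rho_co v x aF cL).
Qed.

Lemma null_frame_dichotomy : let a := co1 F (D u) in let b := co2 F (D u) in
  let d := co1 F (D v) in let p := co1 F (rho v u) in
  let q := co2 F (rho v u) in let r := co1 F (rho v v) in
  [/\ p = 0, q = 0 & r = 0] \/ [/\ a = 0, b = 0, q * d = 0 & p * d = 0].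
Proof.
move=> a b d p q r.
have p4 : co2 F (rho v v) = - p := rho_trace_co v aF.
have a4 : co2 F (D v) = - a := D_trace aF.
have E y x c : Clinear J c -> c z = 0 -> (co2 F (D y))^*%C * c (rho v x) =
    c (D (rho y x)) - c (rho y (D x)).
  by move=> cL cz; rewrite -rho_null ?zetaC_D // rho_D (ClinD cL) (ClinN cL).
have Eu x c : Clinear J c -> c z = 0 -> (b^*)%C * c (rho v x) = 0.
  move=> cL cz; rewrite E // (D_co _ aF cL) !rho_u //.
  by rewrite !mul0r addr0 subrr.
have Ev x c : Clinear J c -> c z = 0 -> - (a^*)%C * c (rho v x) =
    co1 F (rho v x) * c (D u) + co2 F (rho v x) * c (D v)
    - (co1 F (D x) * c (rho v u) + co2 F (D x) * c (rho v v)).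
  move=> cL cz; rewrite -rmorphN -a4 E // (D_co _ aF cL).
  by rewrite (rho_co v (D x) aF cL).
apply: scalar_dichotomy; rewrite ?Eu //.
- by rewrite (Ev u) // p4 -/a -/b -/d -/p -/q -/r; ring.
- by rewrite (Ev u) // p4 a4 -/a -/b -/d -/p -/q -/r; ring.
- by rewrite (Ev v) // p4 a4 -/a -/b -/d -/p -/q -/r; ring.
Qed.

Lemma br_co_abelian_D c x y : (forall t, D t = 0) -> Clinear J c -> c z = 0 ->
  c (2 *: L x y) =
    (co2 F x)^*%C * (co1 F y * c (rho v u) + co2 F y * c (rho v v)) -
    (co2 F y)^*%C * (co1 F x * c (rho v u) + co2 F x * c (rho v v)).
Proof.
move=> D0 cL cz; have [F0 _ _] := aF.
have Lz a t : L (a *j z) t = 0 by rewrite cscaleE !brE z_central D0 !scaler0 addr0.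
have Lz' a t : L t (a *j z) = 0 by rewrite brC Lz oppr0.
pose P t := co1 F t *j u + co2 F t *j v.
have PW t : zetaC (P t) = 0.
  by rewrite /P (ClinD zetaC_lin) !(ClinZ zetaC_lin) (zetaCu aF) (zetaCv aF) !mulr0 addr0.
have tE t : t = co0 F t *j z + P t by rewrite /P addrA -F0 -frameE.
have -> : L x y = L (P x) (P y).
  rewrite {1}(tE x) (brDl L (co0 F x *j z)) Lz add0r.
  by rewrite {1}(tE y) (brDr L _ (co0 F y *j z)) Lz' add0r.
rewrite (ClinR cL) rmorph_nat (br_coW cL cz (PW x) (PW y)) /P.
have [_ cu cv] := c1E aF; have [_ du dv] := c2E aF.
rewrite !(ClinD c1L) !(ClinZ c1L) !(ClinD c2L) !(ClinZ c2L) cu cv du dv.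
by rewrite !mulr0 !mulr1 !addr0 !add0r.
Qed.

(** Here z and J z are central, so only the Jacobi identity on W is left.  On
    (u, v, J v) it gives conj p * p = 0, and on (u, J u, v) it gives
    conj q * q = 0. *)
Lemma null_frame_abelian_D : (forall t, D t = 0) ->
  co1 F (rho v u) = 0 /\ co2 F (rho v u) = 0.
Proof.
move=> D0; have B := br_co_abelian_D _ _ D0.
have [_ cu cv] := c1E aF; have [_ du dv] := c2E aF.
set p := co1 F (rho v u); set q := co2 F (rho v u).
have p4 : co2 F (rho v v) = - p := rho_trace_co v aF.
have conjM0 (x : R[i]) : 2 * 'i%C * ((x^*)%C * x) = 0 -> x = 0.
  have I0 : 'i%C != 0 :> R[i] by rewrite eq_complex /= oner_eq0 andbF.
  by move/eqP; rewrite !mulf_eq0 pnatr_eq0 (negPf I0) /= conjc_eq0 orbb => /eqP.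
have Ic : ('i%C)^*%C = - 'i%C :> R[i] by apply/eqP; rewrite eq_complex /= oppr0 !eqxx.
have coE := (ClinN c1L, ClinN c2L, ClinJ c1L, ClinJ c2L, cu, cv, du, dv).
(* doubled brackets avoid the factor 1/2 of [br_rho_mu] *)
have J4 x y t : 2 *: L (2 *: L x y) t = 2 *: L x (2 *: L y t) - 2 *: L y (2 *: L x t).
  by rewrite !brE -!scalerBr jacobi_br.
split; apply: conjM0.
  have := congr1 (co1 F) (J4 u v (J v)); rewrite (ClinD c1L) (ClinN c1L).
  rewrite !(B _ _ _ c1L c1z) !(B _ _ _ c2L c2z) !coE p4 -/p -/q.
  move/eqP; rewrite -subr_eq0 => /eqP <-; rewrite !(mulr1, mulr0, cjE, Ic).
  by move: ('i%C); clear; move=> I; ring.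
have := congr1 (co2 F) (J4 u (J u) v); rewrite (ClinD c2L) (ClinN c2L).
rewrite !(B _ _ _ c2L c2z) !(B _ _ _ c1L c1z) !coE p4 -/p -/q.
move/eqP; rewrite -subr_eq0 => /eqP <-; rewrite !(mulr1, mulr0, cjE, Ic).
by move: ('i%C); clear; move=> I; ring.
Qed.
End NullFrame.

(** The projection of J z to the kernel of [zeta] along z; it acts like J z,
    and together with W it spans ker zeta.  It is locked so that rewriting with
    bilinearity does not expand it. *)
Definition Jz0 := locked (J z - zeta (J z) *: z).

Lemma Jz0_D y : L Jz0 y = D y.
Proof. by rewrite /Jz0 -lock !brE z_central scaler0 oppr0 addr0. Qed.

Lemma zeta_W x : zetaC x = 0 -> zeta x = 0.
Proof. by case/zetaC_eq0. Qed.

Lemma zetaC_cs a x : zetaC x = 0 -> zetaC (a *j x) = 0.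
Proof. by move=> x0; rewrite (ClinZ zetaC_lin) x0 mulr0. Qed.

Lemma zetaC_J x : zetaC x = 0 -> zetaC (J x) = 0.
Proof. by move=> x0; rewrite (ClinJ zetaC_lin) x0 mulr0. Qed.

Lemma split_z x : exists r s w, x = r *: z + s *: J z + w /\ zetaC w = 0.
Proof.
have [F [F0 F1 F2]] := adapted_exists0.
exists (complex.Re (co0 F x)), (complex.Im (co0 F x)), (co1 F x *j fr1 F + co2 F x *j fr2 F).
split; last by rewrite (ClinD zetaC_lin) !(ClinZ zetaC_lin) F1 F2 !mulr0 addr0.
by rewrite {1}(frameE F x) F0 -cscaleE addrA.
Qed.

Lemma br_split r s w r' s' w' :
  L (r *: z + s *: J z + w) (r' *: z + s' *: J z + w') =
    s *: D w' - s' *: D w + L w w'.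
Proof.
rewrite !brE !z_central !zr_central bracket_alt (brC L w (J z)); vring.
Qed.

Lemma br_W_J x y : zetaC x = 0 -> zetaC y = 0 -> L (J x) y = - L x (J y).
Proof.
move=> x0 y0; apply/eqP; rewrite -addr_eq0 -(J_mu JJ nij0) mu_W //.
by rewrite lf0.
Qed.

Lemma line_Jz0 (F : cframe J) y : adapted F -> zeta y = 0 -> co1 F y = 0 -> co2 F y = 0 ->
  exists b, y = b *: Jz0.
Proof.
move=> [F0 _ _] y0 y1 y2; exists (complex.Im (co0 F y)).
have yE : y = co0 F y *j z by rewrite {1}(frameE F y) y1 y2 !cscale0r !addr0 F0.
move: y0; rewrite {1 2}yE !cscaleE !scE zeta_z mulr1 /Jz0 -lock => h.
have -> : complex.Re (co0 F y) = - (complex.Im (co0 F y) * zeta (J z)) by lra.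
by vring.
Qed.

Section NilpotentCase.
Variables (F : cframe J) (aF : adapted F) (d : R[i]).
Hypothesis rho_u : forall c, Clinear J c -> c z = 0 -> forall y, c (rho (fr1 F) y) = 0.
Local Notation u := (fr1 F).
Local Notation v := (fr2 F).
Hypothesis Du : D u = 0.
Hypothesis Dv : D v = d *j u.
Hypothesis rho_vu : co1 F (rho v u) = 0 /\ co2 F (rho v u) = 0.
Let c1L := co1L F.
Let c2L := co2L F.
Let c1z : co1 F z = 0. Proof. by case: (c1E aF). Qed.
Let c2z : co2 F z = 0. Proof. by case: (c2E aF). Qed.
Let c1u : co1 F u = 1. Proof. by case: (c1E aF). Qed.
Let c2u : co2 F u = 0. Proof. by case: (c2E aF). Qed.
Let c1v : co1 F v = 0. Proof. by case: (c1E aF). Qed.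
Let c2v : co2 F v = 1. Proof. by case: (c2E aF). Qed.
Let u0 : zetaC u = 0. Proof. exact: (zetaCu aF). Qed.
Let v0 : zetaC v = 0. Proof. exact: (zetaCv aF). Qed.

Let DE y : D y = (co2 F y * d) *j u.
Proof.
case: aF => F0 _ _; rewrite {1}(frameE F y) F0 !brDr !D_cs D_z Du Dv.
by rewrite !cscaler0 !add0r cscaleA.
Qed.

Let br_u x : zetaC x = 0 -> exists b, L u x = b *: Jz0.
Proof.
move=> x0; have [r1 r2] := rho_vu; apply: line_Jz0 aF _ _ _; rewrite ?zeta_br //.
  apply: double_eq0; rewrite (br_coW aF rho_u c1L c1z u0 x0) c2u r1.
  by rewrite conjc0 !mul0r mulr0 addr0 mulr0 subrr.
apply: double_eq0; rewrite (br_coW aF rho_u c2L c2z u0 x0) c2u r2.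
by rewrite conjc0 !mul0r mulr0 addr0 mulr0 subrr.
Qed.

Let co2_br x y : co2 F (L x y) = 0.
Proof.
have [r [s [w [-> w0]]]] := split_z x; have [r' [s' [w' [-> w0']]]] := split_z y.
rewrite br_split !DE !(ClinD c2L) (ClinN c2L) !(ClinR c2L) !(ClinZ c2L) c2u !mulr0.
rewrite oppr0 !add0r; have [r1 r2] := rho_vu.
apply: double_eq0; rewrite (br_coW aF rho_u c2L c2z w0 w0') r2.
by rewrite rho_trace_co // r1 oppr0 !mulr0 !addr0 !mulr0 subrr.
Qed.

Let T1 := <<[:: Jz0; u; J u]>>%VS.

Let Jz0_T1 : Jz0 \in T1. Proof. by apply: memv_span; rewrite inE eqxx. Qed.

Let cu_T1 a : a *j u \in T1.
Proof.
by rewrite cscaleE; apply: memvD; apply: memvZ; apply: memv_span; rewrite !inE eqxx ?orbT.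
Qed.

Let T1_split y : zeta y = 0 -> co2 F y = 0 -> exists b a, y = b *: Jz0 + a *j u.
Proof.
move=> y0 y2; have [b bE] : exists b, y - co1 F y *j u = b *: Jz0.
  apply: line_Jz0 aF _ _ _.
  - by rewrite !scE y0 (zeta_W (zetaC_cs _ u0)) subrr.
  - by rewrite (ClinD c1L) (ClinN c1L) (ClinZ c1L) c1u mulr1 subrr.
  - by rewrite (ClinD c2L) (ClinN c2L) (ClinZ c2L) y2 c2u mulr0 subrr.
by exists b, (co1 F y); rewrite -bE subrK.
Qed.

Let br_T1 x y : L x y \in T1.
Proof.
have [b [a ->]] := T1_split (zeta_br x y) (co2_br x y).
by apply: memvD; [apply: memvZ|].
Qed.

Let span3 y : y \in T1 -> exists b a, y = b *: Jz0 + a *j u.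
Proof.
rewrite /T1 !span_cons span_nil addv0 => /memv_addP[_ /vlineP[b ->]] [_ /memv_addP[_ /vlineP[r ->]] [_ /vlineP[s ->] ->] ->].
by exists b, (r +i* s)%C; rewrite cscaleE.
Qed.

(** If d = 0, then J z is central and a chain is T1, the line of Jz0, 0.  If
    d <> 0, the Jacobi identity on (u, v, J v) and (u, J u, v) makes u central, and
    a chain is T1, the complex line of u, 0. *)
Lemma nilpotent_case : nilpotent L.
Proof.
have Lu_cs y a x : L y (a *j x) = complex.Re a *: L y x + complex.Im a *: L y (J x).
  by rewrite cscaleE !brE.
case: (eqVneq d 0) => [d0|dn0].
  have D0 y : D y = 0 by rewrite DE d0 mulr0 cscale0r.
  apply: (@nilpotent_of_chain _ _ _ T1 <[Jz0]>%VS) => //.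
    move=> x y /span3[b [a ->]]; rewrite brDr brZr (brC L x Jz0) Jz0_D D0 oppr0 scaler0 add0r.
    have [r [s [w [-> w0]]]] := split_z x.
    have -> : a *j u = 0 *: z + 0 *: J z + a *j u by rewrite !scale0r !add0r.
    rewrite br_split !D0 !scaler0 subrr add0r Lu_cs.
    have [p pE] := br_u w0; have [q qE] := br_u (zetaC_J w0).
    rewrite -[L w (J u)]opprK -br_W_J // (brC L w u) (brC L (J w)) pE qE opprK.
    by rewrite memvD ?memvZ ?memvN ?memvZ ?memv_line.
  move=> x _ /vlineP[k ->]; by rewrite brZr brC Jz0_D D0 oppr0 scaler0.
have [b bE] := br_u v0; have [g gE] := br_u (zetaC_J v0).
have [b2 b2E] := br_u (zetaC_J u0).
have [t [k tE]] := T1_split (zeta_br v (J v)) (co2_br v (J v)).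
have Le y : L y Jz0 = - D y by rewrite brC Jz0_D.
have co1e : co1 F Jz0 = 0.
  by rewrite /Jz0 -lock (ClinD c1L) (ClinN c1L) (ClinJ c1L) (ClinR c1L) c1z !mulr0 subrr.
have LuW w : zetaC w = 0 -> L u w = 0.
  have b20 : b2 = 0.
    have := jacobi_br L u (J u) v; rewrite b2E (br_W_J u0 v0) bE gE !brE !Le Jz0_D D_J Du Dv.
    rewrite !(lf0, oppr0, scaler0, addr0) => /eqP; rewrite scaler_eq0 => /orP[/eqP//|].
    move/eqP/(congr1 (co1 F)); rewrite (ClinZ c1L) c1u mulr1 (Clin0 c1L) => d0.
    by rewrite d0 eqxx in dn0.
  have [b0 g0] : b = 0 /\ g = 0.
    have := jacobi_br L u v (J v).
    rewrite bE tE gE !brE !Le Jz0_D D_J Du Dv !Lu_cs bracket_alt b2E b20.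
    rewrite !(lf0, oppr0, scaler0, scale0r, addr0, add0r) => /(congr1 (co1 F)).
    rewrite !(ClinN c1L, ClinR c1L, ClinJ c1L, ClinZ c1L) c1u mulr1 => E.
    have : (- g +i* b)%C * d = 0.
      have -> : (- g +i* b)%C = b%:C%C * 'i%C - g%:C%C.
        by apply/eqP; rewrite eq_complex /=; apply/andP; split; apply/eqP; ring.
      by rewrite mulrBl -mulrA E; ring.
    move/eqP; rewrite mulf_eq0 (negPf dn0) orbF => /eqP[/eqP].
    by rewrite oppr_eq0 => /eqP ->.
  move=> w0; rewrite (frameW aF w0) brDr !Lu_cs bracket_alt b2E b20 bE gE b0 g0.
  by rewrite !scale0r !scaler0 !addr0.
have Lu x : L x u = 0.
  have [r [s [w [-> w0]]]] := split_z x.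
  have -> : u = 0 *: z + 0 *: J z + u by rewrite !scale0r !add0r.
  by rewrite br_split Du !scale0r scaler0 subrr add0r (brC L w) LuW // oppr0.
have LJu x : L x (J u) = 0.
  have [r [s [w [-> w0]]]] := split_z x.
  have -> : J u = 0 *: z + 0 *: J z + J u by rewrite !scale0r !add0r.
  rewrite br_split D_J Du lf0 !scale0r scaler0 subrr add0r (brC L w) br_W_J //.
  by rewrite LuW ?zetaC_J // !oppr0.
apply: (@nilpotent_of_chain _ _ _ T1 <<[:: u; J u]>>%VS) => //.
  move=> x y /span3[b' [a ->]]; rewrite brDr brZr Lu_cs Lu LJu !scaler0 !addr0 Le DE.
  rewrite memvZ // memvN cscaleE memvD // memvZ // memv_span // !inE eqxx ?orbT //.
move=> x y; rewrite !span_cons span_nil addv0.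
move=> /memv_addP[_ /vlineP[r ->] [_ /vlineP[s ->] ->]].
by rewrite !brE Lu LJu !scaler0 addr0.
Qed.
End NilpotentCase.

(** Cayley-Hamilton for the traceless operator D of the complex plane W. *)
Lemma D_square : exists k, forall y, zetaC y = 0 -> D (D y) = k *j y.
Proof.
have [F aF] := adapted_exists0; set u := fr1 F; set v := fr2 F.
set a := co1 F (D u); set b := co2 F (D u); set d := co1 F (D v).
have Du : D u = a *j u + b *j v by rewrite {1}(frameW aF (zetaC_D u)).
have Dv : D v = d *j u + (- a) *j v.
  by rewrite {1}(frameW aF (zetaC_D v)) (D_trace aF).
have Dlin x y : D (x *j u + y *j v) = (x * a + y * d) *j u + (x * b + y * - a) *j v.
  by rewrite brDr !D_cs Du Dv !cscaleDr !cscaleA // !cscaleDl addrACA.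
exists (a * a + b * d) => y y0; rewrite (frameW aF y0) -/u -/v !Dlin cscaleDr !cscaleA //.
by congr (_ *j _ + _ *j _); ring.
Qed.

(** The image of D + l lies in the eigenspace of l, as (D - l) (D + l) = 0.
    If D + l = 0 on W, then l = 0 because D is traceless. *)
Lemma D_eigenvector l k : (forall y, zetaC y = 0 -> D (D y) = k *j y) -> l ^+ 2 = k ->
  exists u, [/\ u != 0, zetaC u = 0 & D u = l *j u].
Proof.
move=> DD lk; have [F aF] := adapted_exists0; set u := fr1 F; set v := fr2 F.
have [_ c1u _] := c1E aF; have [_ _ c2v] := c2E aF.
have u0 : zetaC u = 0 := zetaCu aF; have v0 : zetaC v = 0 := zetaCv aF.
have W y : zetaC y = 0 -> zetaC (D y + l *j y) = 0 /\ D (D y + l *j y) = l *j (D y + l *j y).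
  move=> y0; split; first by rewrite (ClinD zetaC_lin) zetaC_D zetaC_cs // addr0.
  by rewrite brDr D_cs DD // cscaleDr cscaleA // -expr2 lk addrC.
case: (eqVneq (D u + l *j u) 0) => [uE|]; last by case: (W u u0); exists (D u + l *j u).
case: (eqVneq (D v + l *j v) 0) => [vE|]; last by case: (W v v0); exists (D v + l *j v).
have au : co1 F (D u) = - l.
  move: (congr1 (co1 F) uE); rewrite (ClinD (co1L F)) (ClinZ (co1L F)) c1u mulr1.
  by rewrite (Clin0 (co1L F)) => /eqP; rewrite addr_eq0 => /eqP.
have av : co2 F (D v) = - l.
  move: (congr1 (co2 F) vE); rewrite (ClinD (co2L F)) (ClinZ (co2L F)) c2v mulr1.
  by rewrite (Clin0 (co2L F)) => /eqP; rewrite addr_eq0 => /eqP.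
have l0 : l = 0.
  have := D_trace aF; rewrite -/u -/v av au opprK => /eqP.
  by rewrite eqNr => /eqP.
exists u; split=> //.
  by apply/eqP => u00; move: c1u; rewrite -/u u00 (Clin0 (co1L F)) => /eqP; rewrite eq_sym oner_eq0.
by move: uE; rewrite l0 !cscale0r addr0.
Qed.

Section FlatCase.
Hypothesis flat : forall x y c, zetaC x = 0 -> zetaC y = 0 -> Clinear J c -> c z = 0 ->
  c (rho x y) = 0.

Lemma br_flat x y : zetaC x = 0 -> zetaC y = 0 -> exists b, L x y = b *: Jz0.
Proof.
move=> x0 y0; have [F aF] := adapted_exists0.
have [c1z _ _] := c1E aF; have [c2z _ _] := c2E aF.
have H c : Clinear J c -> c z = 0 -> c (L x y) = 0.
  move=> cL cz; apply: double_eq0; rewrite -(rmorph_nat (real_complex R)) -(ClinR cL).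
  by rewrite (br_W x0 y0) (ClinD cL) (ClinN cL) !flat // subrr.
by apply: line_Jz0 aF _ _ _; [exact: zeta_br|exact: H (co1L F) c1z|exact: H (co2L F) c2z].
Qed.

Lemma flat_nilpotent : (forall y, zetaC y = 0 -> D (D y) = 0) -> nilpotent L.
Proof.
move=> DD; have [u [un0 u0 Du]] : exists u, [/\ u != 0, zetaC u = 0 & D u = 0 *j u].
  by apply: (@D_eigenvector 0 0); [move=> y y0; rewrite cscale0r DD|rewrite expr0n].
rewrite cscale0r in Du; have [F [aF Fu]] := adapted_exists u0 un0.
rewrite -Fu in u0 Du.
have [c1z _ _] := c1E aF; have [c2z _ _] := c2E aF.
apply: (@nilpotent_case F aF (co1 F (D (fr2 F)))) => //.
- move=> c cL cz y; rewrite (rho_co _ y aF cL) !flat ?(zetaCu aF) ?(zetaCv aF) //.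
  by rewrite !mulr0 addr0.
- rewrite {1}(frameW aF (zetaC_D (fr2 F))) (D_trace aF) Du (Clin0 (co1L F)).
  by rewrite oppr0 cscale0r addr0.
- by split; apply: flat => //; rewrite ?(zetaCu aF) ?(zetaCv aF) //; [exact: (co1L F)|exact: (co2L F)].
Qed.

(** By [br_flat] the brackets of W are multiples of [Jz0], and the Jacobi
    identity reads b (x, y) D t + b (y, t) D x + b (t, x) D y = 0.  As D is
    invertible, taking t independent of x and y gives b (x, y) = 0. *)
Lemma flat_semisimple l k : (forall y, zetaC y = 0 -> D (D y) = k *j y) -> l ^+ 2 = k ->
  l != 0 -> exists F, [/\ adapted F, D (fr1 F) = l *j fr1 F,
     D (fr2 F) = (- l) *j fr2 F &
     forall x y, zetaC x = 0 -> zetaC y = 0 -> L x y = 0].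
Proof.
move=> DD lk l0; have [u [un0 u0 Du]] := D_eigenvector DD lk.
have [|v [vn0 v0 Dv]] := @D_eigenvector (- l) k DD; first by rewrite sqrrN.
have uv : cindep2 J u v.
  move=> a b ab; have Dab : (l * a) *j u - (l * b) *j v = 0.
    rewrite -[RHS](br0r L (J z)) -ab brDr !D_cs Du Dv !cscaleA // mulrN cscaleNl.
    by rewrite !(mulrC l).
  have au : (a *+ 2) *j u = 0.
    have : l *j ((a *+ 2) *j u) = 0.
      rewrite -[RHS](cscaler0 J l) -[in RHS]ab -[RHS]addr0 -Dab cscaleDr !cscaleA //.
      by rewrite mulr2n mulrDr cscaleDl addrACA subrr addr0.
    by case/(cscale_eq0 JJ) => [/eqP|//]; rewrite (negPf l0).
  have a0 : a = 0.
    case: (cscale_eq0 JJ au) => [/eqP|/eqP]; last by rewrite (negPf un0).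
    by rewrite mulrn_eq0 => /eqP.
  move: ab; rewrite a0 cscale0r add0r => /(cscale_eq0 JJ)[//|/eqP].
  by rewrite (negPf vn0).
have [F [aF Fu Fv]] := adapted_exists2 u0 v0 uv.
have [c1z c1u c1v] := c1E aF; have [c2z c2u c2v] := c2E aF.
rewrite Fu in c1u c2u; rewrite Fv in c1v c2v.
exists F; rewrite Fu Fv; split=> //.
have Le y : L y Jz0 = - D y by rewrite brC Jz0_D.
have [b bE] := br_flat u0 v0; have [g gE] := br_flat u0 (zetaC_J v0).
have Luu : L u (J u) = 0.
  have [t tE] := br_flat u0 (zetaC_J u0).
  have := jacobi_br L u (J u) v; rewrite tE (br_W_J u0 v0) bE gE !brE !Le Jz0_D D_J Du Dv.
  move/(congr1 (co2 F)); rewrite !(ClinE (co2L F)) c2u c2v !(mulr0, oppr0, addr0, mulr1).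
  move/eqP; rewrite mulf_eq0 oppr_eq0 (negPf l0) orbF => /eqP[->].
  by rewrite scale0r.
have Lvv : L v (J v) = 0.
  have [t tE] := br_flat v0 (zetaC_J v0).
  have := jacobi_br L v (J v) u; rewrite tE (brC L (J v)) (brC L v u) bE gE !brE !Le Jz0_D D_J Du Dv.
  move/(congr1 (co1 F)); rewrite !(ClinE (co1L F)) c1u c1v !(mulr0, oppr0, addr0, mulr1).
  move/eqP; rewrite mulf_eq0 (negPf l0) orbF => /eqP[->].
  by rewrite scale0r.
have [b0 g0] : b = 0 /\ g = 0.
  have := jacobi_br L u v (J u); rewrite Luu (brC L v (J u)) (br_W_J u0 v0) bE gE.
  rewrite !brE !Le Jz0_D D_J Du => /(congr1 (co1 F)).
  rewrite !(ClinE (co1L F)) c1u !(mulr0, subr0, mulr1) => E.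
  have : (g +i* b)%C * l = 0.
    have -> : (g +i* b)%C = b%:C%C * 'i%C + g%:C%C.
      by apply/eqP; rewrite eq_complex /=; apply/andP; split; apply/eqP; ring.
    by rewrite mulrDl -mulrA E; ring.
  by move/eqP; rewrite mulf_eq0 (negPf l0) orbF => /eqP[-> ->].
have Lu_cs y a x : L y (a *j x) = complex.Re a *: L y x + complex.Im a *: L y (J x).
  by rewrite cscaleE !brE.
have LuW w : zetaC w = 0 -> L u w = 0.
  move=> w0; rewrite (frameW aF w0) brDr !Lu_cs Fu Fv bracket_alt Luu bE gE b0 g0.
  by rewrite !scale0r !scaler0 !addr0.
have LvW w : zetaC w = 0 -> L v w = 0.
  move=> w0; rewrite (frameW aF w0) brDr !Lu_cs Fu Fv bracket_alt Lvv (brC L v u).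
  rewrite (brC L v (J u)) (br_W_J u0 v0) bE gE b0 g0.
  by rewrite !(scale0r, oppr0, scaler0, addr0).
move=> x y x0 y0; rewrite (frameW aF x0) Fu Fv !cscaleE !brE !br_W_J // !LuW ?zetaC_J //.
by rewrite !LvW ?zetaC_J // !(oppr0, scaler0, addr0).
Qed.
End FlatCase.

(** The alternative of [null_frame_dichotomy] becomes: either rho vanishes on
    W modulo z, or u is killed by D and by every rho x, which is the situation
    of [nilpotent_case]. *)
Theorem central_factor_structure : nilpotent L \/ exists l F,
  [/\ l != 0, adapted F, D (fr1 F) = l *j fr1 F, D (fr2 F) = (- l) *j fr2 F &
     forall x y, zetaC x = 0 -> zetaC y = 0 -> L x y = 0].
Proof.
have [u [un0 u0 rho_u]] := exists_rho_null.
have [F [aF Fu]] := adapted_exists u0 un0; rewrite -Fu in rho_u u0.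
set v := fr2 F.
have [c1z _ _] := c1E aF; have [c2z _ _] := c2E aF.
have v0 : zetaC v = 0 := zetaCv aF.
have p4 : co2 F (rho v v) = - co1 F (rho v (fr1 F)) := rho_trace_co v aF.
have nil : co1 F (D (fr1 F)) = 0 -> co2 F (D (fr1 F)) = 0 ->
    co1 F (rho v (fr1 F)) = 0 -> co2 F (rho v (fr1 F)) = 0 -> nilpotent L.
  move=> a0 b0 p0 q0; apply: (@nilpotent_case F aF (co1 F (D v))) => //.
  - by rewrite {1}(frameW aF (zetaC_D (fr1 F))) a0 b0 !cscale0r addr0.
  - by rewrite {1}(frameW aF (zetaC_D v)) (D_trace aF) a0 oppr0 cscale0r addr0.
have [[p0 q0 r0]|[a0 b0 qd pd]] := null_frame_dichotomy aF rho_u; last first.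
  left; case: (eqVneq (co1 F (D v)) 0) => [d0|dn0].
    have [] := null_frame_abelian_D aF rho_u; last exact: nil.
    move=> y; case: (aF) => F0 _ _; rewrite {1}(frameE F y) F0 !brDr !D_cs D_z.
    rewrite (frameW aF (zetaC_D (fr1 F))) (frameW aF (zetaC_D (fr2 F))) (D_trace aF).
    by rewrite a0 b0 d0 oppr0 !cscale0r !addr0 !cscaler0 !addr0.
  apply: nil => //; apply/eqP.
    by move/eqP: pd; rewrite mulf_eq0 (negPf dn0) orbF.
  by move/eqP: qd; rewrite mulf_eq0 (negPf dn0) orbF.
have flat x y c : zetaC x = 0 -> zetaC y = 0 -> Clinear J c -> c z = 0 -> c (rho x y) = 0.
  move=> x0 y0 cL cz; rewrite (rho_null aF rho_u) //.
  have F0 : fr0 F = z by case: aF.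
  have ce t : c t = co1 F t * c (fr1 F) + co2 F t * c v.
    by rewrite {1}(frameE F t) !(ClinD cL) !(ClinZ cL) F0 cz mulr0 add0r.
  rewrite (rho_co v y aF cL) ![c (rho _ _)]ce p4 p0 q0 r0.
  by rewrite oppr0 !(mul0r, addr0, mulr0).
have [k DD] := D_square.
case: (eqVneq k 0) => [k0|kn0].
  by left; apply: flat_nilpotent flat _ => y y0; rewrite DD // k0 cscale0r.
right; exists (sqrtc k).
have [||F' HF'] := flat_semisimple flat (l := sqrtc k) DD.
- exact: sqr_sqrtc.
- by rewrite sqrtc_eq0.
exists F'; case: HF' => *; split=> //; by rewrite sqrtc_eq0.
Qed.

End CentralFactor.

(** * The model algebras *)
Section BracketSums.
Variables (R : realType) (V W : vectType R) (L : lieBracket V).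
Lemma br_suml n (G : 'I_n -> V) y : L (\sum_(i < n) G i) y = \sum_(i < n) L (G i) y.
Proof.
elim: n G => [|n IH] G; first by rewrite !big_ord0 br0l.
by rewrite !big_ord_recl brDl IH.
Qed.
Lemma br_sumr n (G : 'I_n -> V) y : L y (\sum_(i < n) G i) = \sum_(i < n) L y (G i).
Proof. by rewrite brC br_suml -sumrN; apply: eq_bigr => i _; rewrite -brC. Qed.
Lemma lf_sum n (f : 'Hom(V, W)) (G : 'I_n -> V) : f (\sum_(i < n) G i) = \sum_(i < n) f (G i).
Proof. exact: linear_sum. Qed.
End BracketSums.

Section Isomorphisms.
Variables (R : realType) (V : vectType R) (L : lieBracket V).
Hypothesis dimV : \dim {:V} = 6%N.

Lemma lie_isomorphic_of_basis (M : lieBracket 'rV[R]_6) (X : 6.-tuple V) :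
  ({:V} <= <<X>>)%VS ->
  (forall f : 'Hom(V, 'rV[R]_6), (forall i : 'I_6, f X`_i = delta_mx 0 i) ->
   forall i j : 'I_6, (i < j)%N ->
     f (L X`_i X`_j) = M (delta_mx 0 i) (delta_mx 0 j)) ->
  lie_isomorphic L M.
Proof.
move=> spanX HX; have Xb : basis_of fullv X by rewrite basisEdim spanX dimV size_tuple.
have lin : linear (fun v => \row_(i < 6) coord X i v).
  by move=> a v w; apply/rowP => i; rewrite !mxE linearP.
pose F : {linear V -> 'rV[R]_6} :=
  HB.pack (fun v => \row_(i < 6) coord X i v) (GRing.isLinear.Build _ _ _ _ _ lin).
pose f : 'Hom(V, 'rV[R]_6) := linfun F.
have fE v : f v = \row_(i < 6) coord X i v by rewrite lfunE.
have fX (i : 'I_6) : f X`_i = delta_mx 0 i.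
  apply/rowP => j; rewrite fE !mxE coord_free ?(basis_free Xb) //= eq_sym.
  by [].
have vE v : v = \sum_(i < 6) coord X i v *: X`_i by apply: coord_basis Xb (memvf v).
exists f; split.
  exists (fun r : 'rV[R]_6 => \sum_(i < 6) r 0 i *: X`_i).
    by move=> v; rewrite [RHS]vE; apply: eq_bigr => i _; rewrite fE mxE.
  move=> r; apply/rowP => i; rewrite linear_sum summxE (bigD1 i) //= linearZ /= fX.
  rewrite !mxE !eqxx mulr1 big1 ?addr0 // => j ji.
  by rewrite linearZ /= fX !mxE eq_sym (negPf ji) andbF mulr0.
have HXX (i j : 'I_6) : f (L X`_i X`_j) = M (f X`_i) (f X`_j).
  rewrite !fX; case: (ltngtP i j) => [ij|ji|/val_inj ->].
  - exact: HX.
  - by rewrite (brC L) (brC M) -(HX f fX j i ji) lfN.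
  - by rewrite !bracket_alt linear0.
move=> x y; have fvE w : f w = \sum_(i < 6) coord X i w *: f X`_i.
  by rewrite {1}(vE w) linear_sum; apply: eq_bigr => i _; rewrite linearZ.
rewrite {1}(vE x) {1}(vE y) (fvE x) (fvE y) !br_suml lf_sum; apply: eq_bigr => i _.
rewrite !br_sumr lf_sum; apply: eq_bigr => j _.
by rewrite !brE !lfE !HXX.
Qed.

End Isomorphisms.

Ltac model_check :=
  apply/rowP; case=> [[|[|[|[|[|[|//]]]]]] ?];
  rewrite /= ?mxE /= /A57_eqs /A517_eqs /e2_e11_eqs /edual2 /edual /= ?mxE -?val_eqE /=
    ?inordK //=; ring.

(** In this section e acts on the abelian span of u, u', v, v', and z is
    central. *)
Section AlmostAbelian.
Variables (R : realType) (V : vectType R) (L : lieBracket V).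
Hypothesis dimV : \dim {:V} = 6%N.
Variables (z e u u' v v' : V).
Hypothesis span6 : forall U : {vspace V}, z \in U -> e \in U -> u \in U -> u' \in U ->
  v \in U -> v' \in U -> ({:V} <= U)%VS.
Hypothesis zc : forall x, L x z = 0.
Hypothesis abel : forall x y, x \in [:: u; u'; v; v'] -> y \in [:: u; u'; v; v'] -> L x y = 0.

Let span_perm (X : seq V) : {subset [:: z; e; u; u'; v; v'] <= X} -> ({:V} <= <<X>>)%VS.
Proof.
by move=> H; apply: span6; apply/memv_span/H; rewrite !inE eqxx ?orbT.
Qed.

Lemma iso_A57 : L e u = u -> L e u' = u' -> L e v = - v -> L e v' = - v' ->
  lie_isomorphic L (A57_R R).
Proof.
move=> eu eu' ev ev'.
apply: (@lie_isomorphic_of_basis _ _ _ dimV _ [tuple u; v; v'; u'; e; z]).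
  apply: span_perm => x; rewrite !inE.
  by do ![case/orP => [->|]; rewrite ?orbT //]; move=> ->; rewrite ?orbT.
move=> f fX.
have fu : f u = delta_mx 0 (inord 0) by have := fX (inord 0); rewrite inordK.
have fv : f v = delta_mx 0 (inord 1) by have := fX (inord 1); rewrite inordK.
have fv' : f v' = delta_mx 0 (inord 2) by have := fX (inord 2); rewrite inordK.
have fu' : f u' = delta_mx 0 (inord 3) by have := fX (inord 3); rewrite inordK.
have u_v : L u v = 0 by rewrite abel // !inE eqxx ?orbT.
have u_v1 : L u v' = 0 by rewrite abel // !inE eqxx ?orbT.
have u_u1 : L u u' = 0 by rewrite abel // !inE eqxx ?orbT.
have v_v1 : L v v' = 0 by rewrite abel // !inE eqxx ?orbT.
have v_u1 : L v u' = 0 by rewrite abel // !inE eqxx ?orbT.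
have v1_u1 : L v' u' = 0 by rewrite abel // !inE eqxx ?orbT.
have eC x : L x e = - L e x := brC L x e.
case=> [[|[|[|[|[|[|//]]]]]] Hi]; case=> [[|[|[|[|[|[|//]]]]]] Hj] //= _;
  rewrite ?(u_v, u_v1, u_u1, v_v1, v_u1, v1_u1, zc, eC, eu, eu', ev, ev');
  rewrite ?lfE ?fu ?fv ?fu' ?fv'.
all: model_check.
Qed.

Lemma iso_A517 a : L e u = a *: u - u' -> L e u' = u + a *: u' ->
  L e v = - a *: v - v' -> L e v' = v - a *: v' ->
  lie_isomorphic L (A517_R a).
Proof.
move=> eu eu' ev ev'.
apply: (@lie_isomorphic_of_basis _ _ _ dimV _ [tuple u; u'; v; v'; e; z]).
  apply: span_perm => x; rewrite !inE.
  by do ![case/orP => [->|]; rewrite ?orbT //]; move=> ->; rewrite ?orbT.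
move=> f fX.
have fu : f u = delta_mx 0 (inord 0) by have := fX (inord 0); rewrite inordK.
have fu' : f u' = delta_mx 0 (inord 1) by have := fX (inord 1); rewrite inordK.
have fv : f v = delta_mx 0 (inord 2) by have := fX (inord 2); rewrite inordK.
have fv' : f v' = delta_mx 0 (inord 3) by have := fX (inord 3); rewrite inordK.
have u_u1 : L u u' = 0 by rewrite abel // !inE eqxx ?orbT.
have u_v : L u v = 0 by rewrite abel // !inE eqxx ?orbT.
have u_v1 : L u v' = 0 by rewrite abel // !inE eqxx ?orbT.
have u1_v : L u' v = 0 by rewrite abel // !inE eqxx ?orbT.
have u1_v1 : L u' v' = 0 by rewrite abel // !inE eqxx ?orbT.
have v_v1 : L v v' = 0 by rewrite abel // !inE eqxx ?orbT.
have eC x : L x e = - L e x := brC L x e.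
case=> [[|[|[|[|[|[|//]]]]]] Hi]; case=> [[|[|[|[|[|[|//]]]]]] Hj] //= _;
  rewrite ?(u_u1, u_v, u_v1, u1_v, u1_v1, v_v1, zc, eC, eu, eu', ev, ev');
  rewrite ?lfE ?fu ?fv ?fu' ?fv'.
all: model_check.
Qed.
End AlmostAbelian.

Section TwoPlanes.
Variables (R : realType) (V : vectType R) (L : lieBracket V).
Hypothesis dimV : \dim {:V} = 6%N.
Variables (t p p' s q q' : V).
Hypothesis span6 : forall U : {vspace V}, t \in U -> p \in U -> p' \in U -> s \in U ->
  q \in U -> q' \in U -> ({:V} <= U)%VS.

Lemma iso_e2_e11 :
  (forall x y, x \in [:: t; p; p'] -> y \in [:: s; q; q'] -> L x y = 0) ->
  L p p' = 0 -> L q q' = 0 -> L t p = - p' -> L t p' = p -> L s q = q' -> L s q' = q ->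
  lie_isomorphic L (e2_e11 R).
Proof.
move=> bc pp qq tp tp' sq sq'.
apply: (@lie_isomorphic_of_basis _ _ _ dimV _ [tuple t; p; p'; s; q; q']).
  by apply: span6; apply: memv_span; rewrite !inE eqxx ?orbT.
move=> f fX.
have fp : f p = delta_mx 0 (inord 1) by have := fX (inord 1); rewrite inordK.
have fp' : f p' = delta_mx 0 (inord 2) by have := fX (inord 2); rewrite inordK.
have fq : f q = delta_mx 0 (inord 4) by have := fX (inord 4); rewrite inordK.
have fq' : f q' = delta_mx 0 (inord 5) by have := fX (inord 5); rewrite inordK.
have t_s : L t s = 0 by rewrite bc // !inE eqxx ?orbT.
have t_q : L t q = 0 by rewrite bc // !inE eqxx ?orbT.
have t_q1 : L t q' = 0 by rewrite bc // !inE eqxx ?orbT.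
have p_s : L p s = 0 by rewrite bc // !inE eqxx ?orbT.
have p_q : L p q = 0 by rewrite bc // !inE eqxx ?orbT.
have p_q1 : L p q' = 0 by rewrite bc // !inE eqxx ?orbT.
have p1_s : L p' s = 0 by rewrite bc // !inE eqxx ?orbT.
have p1_q : L p' q = 0 by rewrite bc // !inE eqxx ?orbT.
have p1_q1 : L p' q' = 0 by rewrite bc // !inE eqxx ?orbT.
case=> [[|[|[|[|[|[|//]]]]]] Hi]; case=> [[|[|[|[|[|[|//]]]]]] Hj] //= _;
  rewrite ?(pp, qq, tp, tp', sq, sq', t_s, t_q, t_q1, p_s, p_q, p_q1, p1_s, p1_q, p1_q1);
  rewrite ?lfE ?fp ?fp' ?fq ?fq'.
all: model_check.
Qed.
End TwoPlanes.

Section CentralFactorClassification.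
Variables (R : realType) (V : vectType R) (L : lieBracket V) (J : 'End(V)).
Hypothesis JJ : forall x, J (J x) = - x.
Hypothesis nij0 : forall x y, nijenhuis L J x y = 0.
Hypothesis dimV : \dim {:V} = 6%N.
Hypothesis uni : unimodular L.
Hypothesis trJ : forall x, lfun_trace (J \o ad L x)%VF = 0.
Variables (z : V) (zeta : {scalar V}).
Hypothesis z_central : forall x, L z x = 0.
Hypothesis zeta_z : zeta z = 1.
Hypothesis zeta_br : forall x y, zeta (L x y) = 0.
Hypothesis nonnil : ~ nilpotent L.
Local Notation "a *j x" := (cscale J a x) (at level 40).

(** The pair (u, v) diagonalizes D with eigenvalues l = x + i y and - l.  If
    y = 0, rescale the acting vector by 1 / x, otherwise by 1 / y or - 1 / y; the
    choice of sign makes the parameter non-negative, and the order of (u, J u) and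
    (v, J v) absorbs it. *)
Lemma central_factor_classification :
  lie_isomorphic L (A57_R R) \/ exists a : R, 0 <= a /\ lie_isomorphic L (A517_R a).
Proof.
have [//|[l [F [l0 aF Du Dv abel]]]] :=
  central_factor_structure JJ nij0 dimV uni trJ z_central zeta_z zeta_br.
move: Du Dv; set u := fr1 F; set v := fr2 F => Du Dv.
pose W x := zetaC J zeta x = 0.
have u0 : W u := zetaCu aF; have v0 : W v := zetaCv aF.
have Ju0 : W (J u) := zetaC_J JJ u0; have Jv0 : W (J v) := zetaC_J JJ v0.
have zr x : L x z = 0 by rewrite brC z_central oppr0.
set e0 := Jz0 J z zeta.
have Le y : L e0 y = L (J z) y by exact: Jz0_D.
have DJ y : L (J z) (J y) = J (L (J z) y) by exact: D_J.
have span (k : R) (U : {vspace V}) : k != 0 -> z \in U -> k *: e0 \in U -> u \in U -> J u \in U -> v \in U ->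
    J v \in U -> ({:V} <= U)%VS.
  move=> k0 zU eU uU JuU vU JvU; apply/subvP => x _.
  have JzU : J z \in U.
    have -> : J z = k^-1 *: (k *: e0) + zeta (J z) *: z.
      by rewrite scalerA mulVf // scale1r /e0 /Jz0 -lock subrK.
    by apply: memvD; exact: memvZ.
  case: (aF) => F0 _ _; rewrite (frameE F x) F0 !cscaleE.
  by rewrite !memvD ?memvZ.
case: l l0 Du Dv => x y l0; rewrite !cscaleE /= => Du Dv.
case: (eqVneq y 0) => [y0|yn0].
  have xn0 : x != 0 by apply: contraNneq l0 => x0; rewrite eq_complex /= x0 y0 !eqxx.
  left; apply: (@iso_A57 _ _ _ dimV z (x^-1 *: e0) u (J u) v (J v)) => //.
  - by move=> U *; apply: (span x^-1); rewrite ?invr_neq0.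
  - by move=> a b; rewrite !inE => Ha Hb; apply: abel; [case/or4P: Ha|case/or4P: Hb] => /eqP->.
  - by rewrite brZl Le Du y0 scale0r addr0 scalerA mulVf ?scale1r.
  - by rewrite brZl Le DJ Du y0 scale0r addr0 lfZ scalerA mulVf ?scale1r.
  - by rewrite brZl Le Dv y0 oppr0 scale0r addr0 scalerA mulrN mulVf // scaleN1r.
  - by rewrite brZl Le DJ Dv y0 oppr0 scale0r addr0 lfZ scalerA mulrN mulVf // scaleN1r.
have yV : y^-1 * y = 1 by rewrite mulVf.
right; case: (lerP 0 (x / y)) => [a0|/ltW a0].
  exists (x / y); split=> //.
  apply: (@iso_A517 _ _ _ dimV z (y^-1 *: e0) (J u) u v (J v)) => //.
  - by move=> U *; apply: (span y^-1); rewrite ?invr_neq0.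
  - move=> a b; rewrite !inE => Ha Hb; apply: abel.
      by case/or4P: Ha => /eqP->.
    by case/or4P: Hb => /eqP->.
  - by rewrite brZl Le DJ Du !lfE JJ; vfield.
  - by rewrite brZl Le Du; vfield.
  - by rewrite brZl Le Dv; vfield.
  - by rewrite brZl Le DJ Dv !lfE JJ; vfield.
exists (- (x / y)); split; first by rewrite oppr_ge0.
apply: (@iso_A517 _ _ _ dimV z (- y^-1 *: e0) u (J u) (J v) v) => //.
- by move=> U *; apply: (span (- y^-1)); rewrite ?oppr_eq0 ?invr_neq0.
- move=> a b; rewrite !inE => Ha Hb; apply: abel.
    by case/or4P: Ha => /eqP->.
  by case/or4P: Hb => /eqP->.
- by rewrite brZl Le Du; vfield.
- by rewrite brZl Le DJ Du !lfE JJ; vfield.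
- by rewrite brZl Le DJ Dv !lfE JJ; vfield.
- by rewrite brZl Le Dv; vfield.
Qed.
End CentralFactorClassification.

(** * Unimodular algebras and direct factors *)
Section TraceOnSubspaces.
Variables (R : realType) (V : vectType R).
Implicit Types (f : 'End(V)) (p q : V).

Lemma trace_line f p : p != 0 -> (forall v, f v \in <[p]>%VS) ->
  f p = lfun_trace f *: p.
Proof.
move=> p0 fp; pose X := [tuple p]; have Xf : free X by rewrite seq1_free.
pose phi (i : 'I_1) : {scalar V} := coord X i \o f.
have fE v : f v = coord X ord0 (f v) *: p.
  have := @coord_span _ _ _ X (f v); rewrite big_ord1; apply.
  by rewrite span_seq1.
rewrite (lfun_trace_sum (phi := phi) (X := fun=> p)) ?big_ord1 //.
by move=> v; rewrite big_ord1.
Qed.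

Lemma trace_plane f p q a b c d : free [:: p; q] -> (forall v, f v \in <<[:: p; q]>>%VS) ->
  f p = a *: p + b *: q -> f q = c *: p + d *: q -> lfun_trace f = a + d.
Proof.
move=> Xf fX fp fq; pose X := [tuple p; q].
pose phi (i : 'I_2) : {scalar V} := coord X i \o f.
rewrite (lfun_trace_sum (phi := phi) (X := fun i => X`_i)); last first.
  by move=> v; rewrite {1}(@coord_span _ _ _ X (f v)) //; exact: fX.
have c0 r s : coord X ord0 (r *: p + s *: q) = r.
  have := @coord_sum_free _ _ _ X (fun i => [:: r; s]`_i) ord0 Xf.
  by rewrite !big_ord_recl big_ord0 /= addr0.
have c1 r s : coord X (lift ord0 ord0) (r *: p + s *: q) = s.
  have := @coord_sum_free _ _ _ X (fun i => [:: r; s]`_i) (lift ord0 ord0) Xf.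
  by rewrite !big_ord_recl big_ord0 /= addr0.
by rewrite !big_ord_recl big_ord0 /= fp fq c0 c1 addr0.
Qed.

Lemma plane_mem p q x : x \in <<[:: p; q]>>%VS -> exists a b, x = a *: p + b *: q.
Proof.
rewrite !span_cons span_nil addv0 => /memv_addP[_ /vlineP[a ->] [_ /vlineP[b ->] ->]].
by exists a, b.
Qed.

Lemma mem_plane p q a b : a *: p + b *: q \in <<[:: p; q]>>%VS.
Proof. by rewrite memvD // memvZ // memv_span // !inE eqxx ?orbT. Qed.

Lemma free2P p q : (forall a b, a *: p + b *: q = 0 -> a = 0 /\ b = 0) <-> free [:: p; q].
Proof.
split=> [H|Xf a b ab].
  apply/(@freeP _ _ _ [tuple p; q]) => k; rewrite !big_ord_recl big_ord0 /= addr0.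
  move=> /H[k0 k1] i; case: i => [[|[|//]] Hi]; [rewrite -[RHS]k0|rewrite -[RHS]k1];
    by congr k; apply: val_inj.
have /(@freeP _ _ _ [tuple p; q])/(_ (fun i => [:: a; b]`_i)) := Xf.
rewrite !big_ord_recl big_ord0 /= addr0 => /(_ ab) H.
by split; [have := H ord0|have := H (lift ord0 ord0)].
Qed.

Lemma dim2_basis (U : {vspace V}) : \dim U = 2%N ->
  exists p q, free [:: p; q] /\ U = <<[:: p; q]>>%VS.
Proof.
move=> dU; have := vbasisP U; move: (vbasis U); rewrite dU => X XU.
case/tupleP: X XU => p X; case/tupleP: X => q X; rewrite tuple0 => XU.
exists p, q; split; first exact: basis_free XU.
by rewrite (span_basis XU).
Qed.

Lemma dim1_basis (U : {vspace V}) : \dim U = 1%N -> exists p, p != 0 /\ U = <[p]>%VS.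
Proof.
move=> dU; have := vbasisP U; move: (vbasis U); rewrite dU => X XU.
case/tupleP: X XU => p X; rewrite tuple0 => XU.
exists p; split; first by have := basis_free XU; rewrite seq1_free.
by rewrite -(span_basis XU) span_seq1.
Qed.

Lemma separating_scalar (U : {vspace V}) z : z \notin U ->
  exists zeta : {scalar V}, zeta z = 1 /\ forall u, u \in U -> zeta u = 0.
Proof.
move=> zU; pose X := [tuple of z :: vbasis U].
have Xf : free X by rewrite /X /= free_cons (span_basis (vbasisP U)) zU (basis_free (vbasisP U)).
exists (coord X ord0); split.
  by have := coord_free ord0 ord0 Xf; rewrite eqxx.
move=> u uU; rewrite (coord_vbasis uU) linear_sum big1 // => i _.
have := coord_free (lift ord0 i) ord0 Xf.
by rewrite linearZ /= => ->; rewrite mulr0.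
Qed.
End TraceOnSubspaces.

Section UnimodularIdeals.
Variables (R : realType) (V : vectType R) (L : lieBracket V).
Hypothesis uni : unimodular L.

Lemma unimodular_line x p : (forall y, L x y \in <[p]>%VS) -> L x p = 0.
Proof.
move=> Lp; case: (eqVneq p 0) => [->|p0]; first exact: br0r.
have := @trace_line _ _ (ad L x) p p0; rewrite uni scale0r adE; apply=> v.
by rewrite adE.
Qed.

Lemma unimodular_plane x p q a b c d : free [:: p; q] ->
  (forall y, L x y \in <<[:: p; q]>>%VS) ->
  L x p = a *: p + b *: q -> L x q = c *: p + d *: q -> a + d = 0.
Proof.
move=> pq Lx xp xq; rewrite -(uni x).
rewrite (@trace_plane _ _ (ad L x) p q a b c d pq) ?adE // => v.
by rewrite adE.
Qed.

(** If x lies in the ideal, ad x maps into it, so its trace is computed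
    there; for [p, q] = a p + b q, ad p has trace b and ad q has trace - a. *)
Lemma ideal_plane_abelian (U : {vspace V}) : ideal L U -> \dim U = 2%N ->
  forall x y, x \in U -> y \in U -> L x y = 0.
Proof.
move=> idU /dim2_basis[p [q [pq UE]]]; rewrite UE in idU.
have inU x : x \in <<[:: p; q]>>%VS -> forall y, L x y \in <<[:: p; q]>>%VS.
  by move=> xU y; rewrite brC memvN idU.
have pU : p \in <<[:: p; q]>>%VS by rewrite memv_span // !inE eqxx.
have qU : q \in <<[:: p; q]>>%VS by rewrite memv_span // !inE eqxx orbT.
have [a [b pqE]] := plane_mem (inU p pU q).
have b0 : b = 0.
  have := @unimodular_plane p p q 0 0 a b pq (inU p pU); rewrite add0r; apply=> //.
  by rewrite bracket_alt !scale0r addr0.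
have a0 : a = 0.
  have := @unimodular_plane q p q (- a) (- b) 0 0 pq (inU q qU); rewrite addr0 => H.
  apply/eqP; rewrite -oppr_eq0; apply/eqP/H; last by rewrite bracket_alt !scale0r addr0.
  by rewrite brC pqE opprD !scaleNr.
have pq0 : L p q = 0 by rewrite pqE a0 b0 !scale0r addr0.
move=> x y; rewrite UE => /plane_mem[r [s ->]] /plane_mem[r' [s' ->]].
by rewrite !brE !bracket_alt pq0 (brC L q p) pq0 !(oppr0, scaler0, addr0).
Qed.
End UnimodularIdeals.

Section DirectProducts.
Variables (R : realType) (V : vectType R) (L : lieBracket V).
Implicit Types b c : {vspace V}.

Definition direct_product b c :=
  [/\ ideal L b, ideal L c, (b :&: c = 0)%VS & (b + c)%VS = fullv].

Lemma direct_productC b c : direct_product b c -> direct_product c b.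
Proof. by case=> ib ic bc0 bcf; split; rewrite // ?(capvC c) ?(addvC c). Qed.

Lemma bracketv_mem (U W : {vspace V}) x y : x \in U -> y \in W -> L x y \in bracketv L U W.
Proof. by move=> xU yW; apply: ((bracketv_subP L U W _).1 (subvv _)). Qed.

Section Factor.
Variables b c : {vspace V}.
Hypothesis bc : direct_product b c.

Lemma factor_split x : exists y w, [/\ y \in b, w \in c & x = y + w].
Proof.
case: bc => _ _ _ bcf; have := memvf x; rewrite -bcf => /memv_addP[y yb [w wc ->]].
by exists y, w.
Qed.

Lemma factor_cap x : x \in b -> x \in c -> x = 0.
Proof.
case: bc => _ _ bc0 _ xb xc; apply/eqP; rewrite -memv0 -bc0 memv_cap xb xc //.
Qed.

Lemma factor_comm x y : x \in b -> y \in c -> L x y = 0.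
Proof.
case: bc => ib ic _ _ xb yc; apply: factor_cap; last exact: ic.
by rewrite brC memvN; apply: ib.
Qed.

Lemma factor_commC x y : x \in b -> y \in c -> L y x = 0.
Proof. by move=> xb yc; rewrite brC factor_comm // oppr0. Qed.

Lemma bracketv_factor_sub : (bracketv L b b <= b)%VS.
Proof. by apply/bracketv_subP => x y _ yb; case: bc => ib _ _ _; apply: ib. Qed.

Lemma bracketv_factor_br x y : x \in b -> L x y \in bracketv L b b.
Proof.
move=> xb; have [y1 [y2 [y1b y2c ->]]] := factor_split y.
by rewrite brDr (factor_comm xb y2c) addr0 bracketv_mem.
Qed.

Lemma bracketv_factor_ideal : ideal L (bracketv L b b).
Proof.
by move=> x y yP; rewrite brC memvN bracketv_factor_br // (subvP bracketv_factor_sub).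
Qed.

(** Otherwise b would lie in every term of the derived series. *)
Lemma solvable_factor : solvable L -> b != 0%VS -> bracketv L b b != b.
Proof.
move=> [n sol] b0; apply/eqP => Pb; have : (b <= derived_series L n)%VS.
  elim: n {sol} => [|n IH]; first exact: subvf.
  rewrite -Pb; apply/bracketv_subP => x y xb yb.
  by apply: bracketv_mem; apply: (subvP IH).
by rewrite sol subv0 (negPf b0).
Qed.

Hypothesis uni : unimodular L.

Definition heisenberg_factor := exists p, [/\ p != 0, p \in b, forall x, L p x = 0 &
  forall x y, x \in b -> y \in b -> L x y \in <[p]>%VS].

(** The algebra e(1,1) for s = 1 and e(2) for s = - 1. *)
Definition plane_factor (s : R) := exists t p p',
  [/\ b = <<[:: t; p; p']>>%VS, free [:: t; p; p'], L p p' = 0,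
      L t p = p' & L t p' = s *: p].

Lemma heisenberg_factor_of_dim1 : \dim (bracketv L b b) = 1%N -> heisenberg_factor.
Proof.
move/dim1_basis => [p [p0 PE]]; have pP : p \in bracketv L b b by rewrite PE memv_line.
have pb := subvP bracketv_factor_sub _ pP.
exists p; split=> // [x|x y xb yb]; last by rewrite -PE bracketv_mem.
have pc x' y' : x' \in b -> y' \in c -> L (x' + y') p = 0.
  move=> xb yc; rewrite brDl (factor_commC pb yc) addr0.
  by apply: (unimodular_line uni) => y; rewrite -PE bracketv_factor_br.
by have [y [w [yb wc ->]]] := factor_split x; rewrite brC pc // oppr0.
Qed.

(** A is traceless, so A^2 is a scalar, here non-zero; hence A is not a
    scalar and some vector p is independent of A p.  [d r s] is the determinant of
    (p, A p) for p = r p1 + s p2. *)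
Lemma plane_cyclic_vector (A : V -> V) (p1 p2 : V) (a1 b1 c1 : R) : free [:: p1; p2] ->
  (forall r s, A (r *: p1 + s *: p2) = r *: A p1 + s *: A p2) ->
  A p1 = a1 *: p1 + b1 *: p2 -> A p2 = c1 *: p1 - a1 *: p2 -> a1 ^+ 2 + b1 * c1 != 0 ->
  exists p, [/\ p \in <<[:: p1; p2]>>%VS, free [:: p; A p] &
    A (A p) = (a1 ^+ 2 + b1 * c1) *: p].
Proof.
move=> /free2P pf Alin Ap1 Ap2 k0.
pose d r s := r * (r * b1 - s * a1) - s * (r * a1 + s * c1).
have [r [s drs]] : exists r s, d r s != 0.
  case: (eqVneq b1 0) => [b0|bn0]; last by exists 1, 0; rewrite /d !mul1r !mul0r !subr0.
  case: (eqVneq c1 0) => [c0|cn0]; last first.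
    by exists 0, 1; rewrite /d !mul1r !mul0r !add0r oppr_eq0.
  exists 1, 1; rewrite /d b0 c0 !mul1r addr0 add0r -opprD oppr_eq0.
  by move: k0; rewrite b0 mul0r addr0 expf_eq0 /= => a0; rewrite -mulr2n mulrn_eq0.
have AE r' s' : A (r' *: p1 + s' *: p2) = (r' * a1 + s' * c1) *: p1 + (r' * b1 - s' * a1) *: p2.
  by rewrite Alin Ap1 Ap2; vring.
exists (r *: p1 + s *: p2); split; first exact: mem_plane.
  apply/free2P => x y; rewrite AE => E.
  have [e1 e2] : r * x + (r * a1 + s * c1) * y = 0 /\ s * x + (r * b1 - s * a1) * y = 0.
    by apply: pf; rewrite -[RHS]E; vring.
  have y0 : y = 0.
    have : d r s * y = 0.
      have -> : d r s * y = r * (s * x + (r * b1 - s * a1) * y) - s * (r * x + (r * a1 + s * c1) * y).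
        by rewrite /d; ring.
      by rewrite e1 e2 !mulr0 subrr.
    by move/eqP; rewrite mulf_eq0 (negPf drs) => /eqP.
  have x0 : d r s * x = 0.
    move: e1 e2; rewrite y0 !mulr0 !addr0 => /eqP e1 /eqP e2.
    apply/eqP; rewrite mulf_eq0; apply/orP; right.
    move: e1 e2; rewrite !mulf_eq0 => /orP[/eqP r0|//] /orP[/eqP s0|//].
    by move: drs; rewrite /d r0 s0 !mul0r subrr eqxx.
  by move/eqP: x0; rewrite mulf_eq0 (negPf drs) => /eqP.
rewrite !AE; vring.
Qed.

(** The plane [b, b] is abelian and equals [t, [b, b]] for any t of b outside
    it, so t acts on it by a traceless invertible operator, whose square is a
    scalar k.  Dividing t by the square root of |k| normalizes k to 1 or - 1. *)
Lemma plane_factor_of_dim2 : \dim b = 3%N -> \dim (bracketv L b b) = 2%N ->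
  plane_factor 1 \/ plane_factor (-1).
Proof.
move=> db dP; have abel := ideal_plane_abelian uni bracketv_factor_ideal dP.
have [p1 [p2 [pf PE]]] := dim2_basis dP.
have p1P : p1 \in bracketv L b b by rewrite PE memv_span // !inE eqxx.
have p2P : p2 \in bracketv L b b by rewrite PE memv_span // !inE eqxx orbT.
have Pb := bracketv_factor_sub.
have [t tb tP] : exists2 t, t \in b & t \notin bracketv L b b.
  apply/subvPn; apply: contraL isT => /dimvS; by rewrite db dP.
have Lt y : L t y \in <<[:: p1; p2]>>%VS by rewrite -PE bracketv_factor_br.
have [a1 [b1 tp1]] := plane_mem (Lt p1); have [c1 [d1 tp2]] := plane_mem (Lt p2).
have d1E : d1 = - a1.
  by apply/eqP; rewrite -addr_eq0 addrC (unimodular_plane uni pf Lt tp1 tp2).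
rewrite d1E scaleNr in tp2.
have bE t0 p p' : t0 \in b -> t0 \notin bracketv L b b -> free [:: p; p'] -> p \in bracketv L b b -> p' \in bracketv L b b ->
    free [:: t0; p; p'] /\ b = <<[:: t0; p; p']>>%VS.
  move=> t0b t0P pf' pP p'P; have PE' : bracketv L b b = <<[:: p; p']>>%VS.
    apply/eqP; rewrite eq_sym eqEdim dP; apply/andP; split.
      by apply/span_subvP => y; rewrite !inE => /orP[] /eqP->.
    by rewrite (eqP pf').
  have fr : free [:: t0; p; p'] by rewrite free_cons -PE' t0P.
  split=> //; apply/eqP; rewrite eq_sym eqEdim db (eqP fr) leqnn andbT.
  apply/span_subvP => y; rewrite !inE => /or3P[] /eqP-> //; exact: (subvP Pb).
pose k := a1 ^+ 2 + b1 * c1.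
have LtLt y : y \in bracketv L b b -> L t (L t y) = k *: y.
  rewrite PE => /plane_mem[r [s ->]]; rewrite !brE tp1 tp2 !brE tp1 tp2 /k; vring.
have k0 : k != 0.
  apply/eqP => k0; have [_ bE'] := bE t p1 p2 tb tP pf p1P p2P.
  have dec w : w \in b -> exists r w', w' \in bracketv L b b /\ w = r *: t + w'.
    move=> wb; have : w \in <<[:: t; p1; p2]>>%VS by rewrite -bE'.
    rewrite span_cons -PE => /memv_addP[_ /vlineP[r ->] [w' w'P ->]].
    by exists r, w'.
  have onto y : y \in bracketv L b b -> exists2 w, w \in bracketv L b b & y = L t w.
    have : (bracketv L b b <= ad L t @: bracketv L b b)%VS.
      apply/bracketv_subP => x x' /dec[r [w [wP ->]]] /dec[r' [w' [w'P ->]]].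
      have -> : L (r *: t + w) (r' *: t + w') = ad L t (r *: w' - r' *: w).
        by rewrite adE !brE bracket_alt (abel w w') // (brC L w t); vring.
      by rewrite memv_img // memvB // memvZ.
    by move=> sub /(subvP sub) /memv_imgP[w wP ->]; exists w; rewrite ?adE.
  have [w /onto[w' w'P ->]] := onto _ p1P; rewrite LtLt // k0 scale0r => p10.
  by have := free_not0 pf (mem_head p1 _); rewrite p10 eqxx.
have [p [pP pf' AAp]] : exists p, [/\ p \in <<[:: p1; p2]>>%VS, free [:: p; L t p] &
    L t (L t p) = k *: p].
  by apply: plane_cyclic_vector tp1 tp2 k0 => // r s; rewrite !brE.
rewrite -PE in pP.
pose m := Num.sqrt `|k|; have m0 : m != 0 by rewrite sqrtr_eq0 -ltNge normr_gt0.
have m2 : m ^+ 2 = `|k| by rewrite sqr_sqrtr.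
have main s : k = s * m ^+ 2 -> plane_factor s.
  move=> ks; have tpP : L t p \in bracketv L b b by rewrite bracketv_factor_br.
  have pf'' : free [:: p; m^-1 *: L t p].
    apply/free2P => x y; rewrite scalerA => /((free2P _ _).2 pf')[-> /eqP].
    by rewrite mulf_eq0 invr_eq0 (negPf m0) orbF => /eqP ->.
  have tmb : m^-1 *: t \in b by rewrite memvZ.
  have tmP : m^-1 *: t \notin bracketv L b b.
    by apply: contra tP => /(memvZ m); rewrite scalerA divff // scale1r.
  have [fr bE'] := bE _ p (m^-1 *: L t p) tmb tmP pf'' pP (memvZ _ tpP).
  exists (m^-1 *: t), p, (m^-1 *: L t p); split=> //.
  - by rewrite brZr abel ?scaler0.
  - by rewrite brZl.
  - rewrite brZl brZr AAp !scalerA ks; congr (_ *: _); by field.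
case: (lerP 0 k) => k_sgn; [left|right]; apply: main; rewrite m2.
  by rewrite ger0_norm // mul1r.
by rewrite ltr0_norm // mulN1r opprK.
Qed.

End Factor.
End DirectProducts.

(** * J-stable subspaces *)
Section ComplexSubspaces.
Variables (R : realType) (V : vectType R) (J : 'End(V)).
Hypothesis JJ : forall x, J (J x) = - x.
Local Notation "a *j x" := (cscale J a x) (at level 40).

Definition J_stable (U : {vspace V}) := forall x, x \in U -> J x \in U.

Lemma cline_mem x y : y \in <<[:: x; J x]>>%VS -> exists a, y = a *j x.
Proof. by move/plane_mem=> [a [b ->]]; exists (a +i* b)%C; rewrite cscaleE. Qed.

Lemma free_cline x : x != 0 -> free [:: x; J x].
Proof.
move=> x0; apply/free2P => a b ab.
have /(cscale_eq0 JJ)[] : (a +i* b)%C *j x = 0 by rewrite cscaleE.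
  by case.
by move/eqP; rewrite (negPf x0).
Qed.

Lemma cplane_mem x y w : w \in <<[:: x; J x; y; J y]>>%VS -> exists a b, w = a *j x + b *j y.
Proof.
rewrite -(cat1s x) -(cat1s (J x)) catA span_cat => /memv_addP[w1 /cline_mem[a ->]].
by case=> w2 /cline_mem[b ->] ->; exists a, b.
Qed.

Lemma free_cplane x y : cindep2 J x y -> free [:: x; J x; y; J y].
Proof.
move=> xy; apply/(@freeP _ _ _ [tuple x; J x; y; J y]) => k.
rewrite !big_ord_recl big_ord0 /= addr0 => E.
set k0 := k _ in E; set k1 := k _ in E; set k2 := k _ in E; set k3 := k _ in E.
have [] := xy (k0 +i* k1)%C (k2 +i* k3)%C.
  by rewrite !cscaleE /= -addrA.
case=> k00 k10; case=> k20 k30.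
case=> [[|[|[|[|//]]]] Hi]; [rewrite -[RHS]k00|rewrite -[RHS]k10|rewrite -[RHS]k20|rewrite -[RHS]k30];
  by congr k; apply: val_inj.
Qed.

Lemma stable_cindep (U : {vspace V}) x : J_stable U -> x \in U -> x != 0 -> (2 < \dim U)%N ->
  exists2 y, y \in U & cindep2 J x y.
Proof.
move=> JU xU x0 dU.
have [y yU yx] : exists2 y, y \in U & y \notin <<[:: x; J x]>>%VS.
  apply/subvPn; apply: contraL dU => /dimvS; rewrite -leqNgt => /leq_trans; apply.
  exact: dim_span.
exists y => // a b ab; have b0 : b = 0.
  apply/eqP; apply: contraNT yx => b0; rewrite addrC in ab.
  rewrite (cscale_sum2_eq0 JJ b0 ab) cscaleE; exact: mem_plane.
move: ab; rewrite b0 cscale0r addr0 => /(cscale_eq0 JJ)[//|/eqP].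
by rewrite (negPf x0).
Qed.

(** In particular a J-stable subspace cannot have dimension 3. *)
Lemma stable_dim_gt2 (U : {vspace V}) : J_stable U -> (2 < \dim U)%N ->
  exists x y, [/\ x \in U, y \in U, cindep2 J x y & (3 < \dim U)%N] /\
    (\dim U = 4%N -> U = <<[:: x; J x; y; J y]>>%VS).
Proof.
move=> JU dU; have [x xU x0] : exists2 x, x \in U & x != 0.
  exists (vpick U); rewrite ?memv_pick // vpick0 -dimv_eq0.
  by case: (\dim U) dU.
have [y yU xy] := stable_cindep JU xU x0 dU.
have sub : (<<[:: x; J x; y; J y]>> <= U)%VS.
  by apply/span_subvP => w; rewrite !inE => /or4P[] /eqP->; rewrite ?JU.
exists x, y; split.
  by split=> //; have := dimvS sub; rewrite (eqP (free_cplane xy)).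
by move=> dU4; apply/eqP; rewrite eq_sym eqEdim sub dU4 (eqP (free_cplane xy)).
Qed.
End ComplexSubspaces.

Section ComplexTraces.
Variables (R : realType) (V : vectType R) (L : lieBracket V) (J : 'End(V)).
Hypothesis JJ : forall x, J (J x) = - x.
Hypothesis nij0 : forall x y, nijenhuis L J x y = 0.
Hypothesis dimV : \dim {:V} = 6%N.
Hypothesis uni : unimodular L.
Hypothesis trJ : forall x, lfun_trace (J \o ad L x)%VF = 0.
Local Notation "a *j x" := (cscale J a x) (at level 40).
Local Notation rho := (rho L J).

(** If ad x maps V into the complex line of m, its J-linear part there is a
    complex number, and the traces of ad x and J ad x are its real and imaginary
    parts up to a factor, so it vanishes. *)
Lemma cline_trace x m : (forall y, L x y \in <<[:: m; J m]>>%VS) ->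
  L x m = J (L x (J m)).
Proof.
move=> Lx; case: (eqVneq m 0) => [->|m0]; first by rewrite lf0 br0r lf0.
have mf := free_cline JJ m0.
have [a [b xm]] := plane_mem (Lx m); have [c [d xJm]] := plane_mem (Lx (J m)).
have e1 := unimodular_plane uni mf Lx xm xJm.
have e2 : - b + c = 0.
  rewrite -(trJ x) (@trace_plane _ _ _ m (J m) (- b) a (- d) c mf) //.
  - move=> v; rewrite comp_lfunE adE; have [r [s ->]] := plane_mem (Lx v).
    have -> : J (r *: m + s *: J m) = (- s) *: m + r *: J m by rewrite !lfE JJ; vring.
    exact: mem_plane.
  - by rewrite comp_lfunE adE xm !lfE JJ; vring.
  - by rewrite comp_lfunE adE xJm !lfE JJ; vring.
have -> : L x m = a *: m + b *: J m by [].
rewrite xJm !lfE JJ; have -> : d = - a by lra.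
have -> : c = b by lra.
vring.
Qed.

(** Cayley-Hamilton for the traceless operator rho x on a complex plane that
    contains its image. *)
Lemma rho_square x u v : cindep2 J u v -> (forall y, exists a b, rho x y = a *j u + b *j v) ->
  exists k, forall a b, rho x (rho x (a *j u + b *j v)) = k *j (a *j u + b *j v).
Proof.
move=> uv im; have [w uvw] := cindep3_ext JJ dimV uv.
have [F [F0 F1 F2]] := cframe_of JJ dimV uvw.
have [a [b xu]] := im u; have [c [d xv]] := im v; have [a' [b' xw]] := im w.
have da : d = - a.
  have := rho_trace JJ nij0 uni trJ F x; rewrite /frame_trace F0 F1 F2 xu xv xw.
  have [] := co0E F; have [] := co1E F; have [] := co2E F; rewrite F0 F1 F2.
  rewrite !(ClinD (co0L F), ClinZ (co0L F), ClinD (co1L F), ClinZ (co1L F), ClinD (co2L F), ClinZ (co2L F)).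
  move=> -> -> _ -> -> _ -> -> _; rewrite !(mulr0, mulr1, addr0, add0r) => /eqP.
  by rewrite addrC addr_eq0 => /eqP.
have lin r s : rho x (r *j u + s *j v) = (r * a + s * c) *j u + (r * b + s * - a) *j v.
  by rewrite rhoDr !rhoZr // xu xv da !cscaleDr !cscaleA // !cscaleDl addrACA.
exists (a * a + b * c) => r s; rewrite !lin cscaleDr !cscaleA //.
by congr (_ *j _ + _ *j _); ring.
Qed.
End ComplexTraces.

(** * Products of two plane factors *)
Section TwoPlaneFactors.
Variables (R : realType) (V : vectType R) (L : lieBracket V) (J : 'End(V)).
Hypothesis JJ : forall x, J (J x) = - x.
Hypothesis nij0 : forall x y, nijenhuis L J x y = 0.
Hypothesis dimV : \dim {:V} = 6%N.
Hypothesis uni : unimodular L.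
Hypothesis trJ : forall x, lfun_trace (J \o ad L x)%VF = 0.
Local Notation "a *j x" := (cscale J a x) (at level 40).
Local Notation rho := (rho L J).

(** The plane is the complex line of m and ad x maps V into it.  As ad x is
    J-linear at m, [cline_trace] gives [x, m] = J J [x, m] = - [x, m]. *)
Lemma stable_plane_absurd x m q q' : L x m != 0 -> m \in <<[:: q; q']>>%VS ->
  J m \in <<[:: q; q']>>%VS -> (forall y, L x y \in <<[:: q; q']>>%VS) ->
  L x (J m) = J (L x m) -> False.
Proof.
move=> Lm mq Jmq Lq LJ; have m0 : m != 0 by apply: contraNneq Lm => ->; rewrite br0r.
have sub : (<<[:: m; J m]>> <= <<[:: q; q']>>)%VS.
  by apply/span_subvP => w; rewrite !inE => /orP[] /eqP->.
have E : <<[:: m; J m]>>%VS = <<[:: q; q']>>%VS.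
  by apply/eqP; rewrite eqEdim sub (eqP (free_cline JJ m0)) dim_span.
have := @cline_trace _ _ _ _ JJ uni trJ x m; rewrite E LJ JJ => /(_ Lq) /eqP.
by rewrite eq_sym -subr_eq0 -opprD oppr_eq0 -mulr2n -scaler_nat scaler_eq0 pnatr_eq0 (negPf Lm).
Qed.

Variables (t p p' s q q' : V) (eps del : R).
Hypothesis free6 : free [:: t; s; p; p'; q; q'].
Hypothesis eps0 : eps != 0.
Hypothesis del0 : del != 0.
Hypothesis comm : forall x y, x \in [:: t; p; p'] -> y \in [:: s; q; q'] -> L x y = 0.
Hypothesis pp' : L p p' = 0.
Hypothesis qq' : L q q' = 0.
Hypothesis tp : L t p = p'.
Hypothesis tp' : L t p' = eps *: p.
Hypothesis sq : L s q = q'.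
Hypothesis sq' : L s q' = del *: q.

Let N := <<[:: p; p'; q; q']>>%VS.

Let brackets : [/\ L s t = 0, L s p = 0, L s p' = 0, L t q = 0 & L t q' = 0] /\
  [/\ L p q = 0, L p q' = 0, L p' q = 0 & L p' q' = 0].
Proof.
by split; split; rewrite ?(brC L s) comm ?inE ?eqxx ?orbT ?oppr0.
Qed.

Let N_split y : y \in N -> exists a b c d, y = a *: p + b *: p' + c *: q + d *: q'.
Proof.
rewrite /N !span_cons span_nil addv0 => /memv_addP[_ /vlineP[a ->]].
case=> _ /memv_addP[_ /vlineP[b ->] [_ /memv_addP[_ /vlineP[c ->] [_ /vlineP[d ->] ->]] ->]] ->.
by exists a, b, c, d; rewrite !addrA.
Qed.

Let V_split x : exists a b n, n \in N /\ x = a *: t + b *: s + n.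
Proof.
have : basis_of fullv [:: t; s; p; p'; q; q'] by rewrite basisEfree free6 subvf dimV.
move/span_basis => E; have := memvf x; rewrite -E !span_cons -!span_cons.
rewrite (span_cons t) => /memv_addP[_ /vlineP[a ->] [w]].
rewrite span_cons => /memv_addP[_ /vlineP[b ->] [n nN ->]] ->.
by exists a, b, n; rewrite addrA.
Qed.

Let N_abel x y : x \in N -> y \in N -> L x y = 0.
Proof.
have [_ [pq pq' p'q p'q']] := brackets.
move=> /N_split[a [b [c [d ->]]]] /N_split[a' [b' [c' [d' ->]]]].
rewrite !brE !bracket_alt pp' qq' (brC L p' p) (brC L q' q) (brC L q) (brC L q p') (brC L q').
rewrite (brC L q' p') pp' qq' pq pq' p'q p'q' ; by rewrite !(oppr0, scaler0, addr0).
Qed.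

Let Lt_N a b c d : L t (a *: p + b *: p' + c *: q + d *: q') = (b * eps) *: p + a *: p'.
Proof.
have [[_ _ _ tq tq'] _] := brackets.
by rewrite !brE tp tp' tq tq' !scaler0 !addr0 scalerA addrC.
Qed.

Let Ls_N a b c d : L s (a *: p + b *: p' + c *: q + d *: q') = (d * del) *: q + c *: q'.
Proof.
have [[_ sp sp' _ _] _] := brackets.
by rewrite !brE sq sq' sp sp' !scaler0 !add0r scalerA addrC.
Qed.

Let L_tP y : L t y \in <<[:: p; p']>>%VS.
Proof.
have [[st _ _ _ _] _] := brackets.
have [a [b [n [/N_split[x1 [x2 [x3 [x4 ->]]]] ->]]]] := V_split y.
rewrite (brDr L t) (brDr L t) !brZr bracket_alt (brC L t s) st Lt_N !scaler0 oppr0 scaler0 !add0r.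
exact: mem_plane.
Qed.

Let L_sQ y : L s y \in <<[:: q; q']>>%VS.
Proof.
have [[st _ _ _ _] _] := brackets.
have [a [b [n [/N_split[x1 [x2 [x3 [x4 ->]]]] ->]]]] := V_split y.
rewrite (brDr L s) (brDr L s) !brZr bracket_alt st Ls_N !scaler0 !add0r.
exact: mem_plane.
Qed.

Let PN : (<<[:: p; p']>> <= N)%VS.
Proof. by apply/span_subvP => w; rewrite !inE => /orP[] /eqP->; rewrite memv_span // !inE eqxx ?orbT. Qed.
Let QN : (<<[:: q; q']>> <= N)%VS.
Proof. by apply/span_subvP => w; rewrite !inE => /orP[] /eqP->; rewrite memv_span // !inE eqxx ?orbT. Qed.

Let br_N x y : L x y \in N.
Proof.
have H n w : n \in N -> L n w \in N.
  move=> nN; have [a [b [m [mN ->]]]] := V_split w.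
  rewrite (brDr L n) (brDr L n) !brZr (N_abel nN mN) addr0 (brC L n t) (brC L n s).
  by rewrite memvD // memvZ // memvN ?(subvP PN _ (L_tP _)) ?(subvP QN _ (L_sQ _)).
have [a [b [m [mN ->]]]] := V_split x.
rewrite (brDl L) (brDl L) !brZl memvD // ?H // memvD // memvZ //.
  exact: (subvP PN _ (L_tP _)).
exact: (subvP QN _ (L_sQ _)).
Qed.

Let freeN : free [:: p; p'; q; q'].
Proof. by move: free6; rewrite !free_cons => /and3P[_ _]. Qed.

Let dimN : \dim N = 4%N. Proof. exact: (eqP freeN). Qed.

Let coordN a b c d : a *: p + b *: p' + c *: q + d *: q' = 0 -> [/\ a = 0, b = 0, c = 0 & d = 0].
Proof.
move=> E; have /(@freeP _ _ _ [tuple p; p'; q; q'])/(_ (fun i => [:: a; b; c; d]`_i)) := freeN.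
rewrite !big_ord_recl big_ord0 /= addr0 !addrA => /(_ E) H.
split; [have := H ord0|have := H (inord 1)|have := H (inord 2)|have := H (inord 3)];
  by rewrite ?inordK.
Qed.

Let t_notin : t \notin N.
Proof.
move: free6; rewrite free_cons => /andP[tn _]; apply: contra tn => tN.
by rewrite span_cons -[t]add0r memv_add ?mem0v.
Qed.

(** Let M be the intersection of N and J N.  If M <> N, then M is a complex line
    for reasons of dimension and parity, and N + J N = V.  As N is abelian, the Nijenhuis
    condition makes every ad x J-linear on M, so t and s act on M by complex
    numbers k and k'.  The images of ad t and ad s lie in different planes, so
    k k' = 0 and M is one of the planes; that contradicts [stable_plane_absurd]. *)
Lemma N_stable : J_stable J N.
Proof.
pose M := (N :&: J @: N)%VS.
have JM : J_stable J M.
  move=> x; rewrite !memv_cap => /andP[xN /memv_imgP[y yN xE]].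
  by rewrite memv_img // xE JJ memvN yN.
have Mimg x : x \in M -> x \in N /\ J x \in N.
  move=> xM; split; first by move: xM; rewrite memv_cap => /andP[].
  by move/JM: xM; rewrite memv_cap => /andP[].
have dJN : \dim (J @: N) = 4%N.
  rewrite -dimN limg_dim_eq //; apply/eqP; rewrite -subv0; apply/subvP => x.
  rewrite memv_cap memv_ker => /andP[_ /eqP Jx]; rewrite memv0.
  by rewrite -oppr_eq0 -JJ Jx lf0.
have dims := dimv_sum_cap N (J @: N)%VS; rewrite dimN dJN in dims.
have dsum : (\dim (N + J @: N) <= 6)%N by rewrite -dimV dimvS // subvf.
have dM2 : (2 <= \dim M)%N.
  by rewrite leqNgt; apply/negP => lt; have := leq_add dsum lt; rewrite addnS dims.
have [dM3|] := ltnP 2 (\dim M).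
  have [x [y [[_ _ _ dM4] _]]] := stable_dim_gt2 JJ JM dM3.
  have MN : M = N by apply/eqP; rewrite eqEdim capvSl dimN.
  by rewrite -MN.
move=> dM2'; have dM : \dim M = 2%N by apply/eqP; rewrite eqn_leq dM2' dM2.
have full : (N + J @: N)%VS = fullv.
  apply/eqP; rewrite eqEdim subvf dimV -(leq_add2r (\dim M)) dims dM //.
have LJ x m : m \in M -> L x (J m) = J (L x m).
  move=> /Mimg[mN JmN]; have := memvf x; rewrite -full => /memv_addP[n nN [_ /memv_imgP[n' n'N ->] ->]].
  rewrite !brDl !(N_abel nN) // !add0r (nijE nij0) (N_abel n'N mN) (N_abel n'N JmN).
  by rewrite lf0 add0r addr0.
have [m mM m0] : exists2 m, m \in M & m != 0.
  by exists (vpick M); rewrite ?memv_pick // vpick0 -dimv_eq0 dM.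
have [mN JmN] := Mimg m mM.
have ME : M = <<[:: m; J m]>>%VS.
  apply/eqP; rewrite eq_sym eqEdim dM (eqP (free_cline JJ m0)) andbT.
  by apply/span_subvP => w; rewrite !inE => /orP[] /eqP->; rewrite ?JM.
have Lm x : exists k, L x m = k *j m.
  apply: cline_mem; rewrite -ME memv_cap br_N /=.
  have -> : L x m = J (- L x (J m)) by rewrite LJ // lfN JJ opprK.
  by rewrite memv_img // memvN br_N.
have [k kE] := Lm t; have [k' k'E] := Lm s.
have kk' : (k * k') *j m = 0.
  have -> : (k * k') *j m = L s (L t m).
    have -> : L s (L t m) = k *j L s m by rewrite kE !cscaleE !brE LJ.
    by rewrite k'E cscaleA.
  have [a [b ->]] := plane_mem (L_tP m).
  by have [[_ sp sp' _ _] _] := brackets; rewrite !brE sp sp' !scaler0 addr0.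
have [a [b [c [d mE]]]] := N_split mN.
have [a' [b' [c' [d' JmE]]]] := N_split JmN.
have P_eq0 x x' y y' : L t (x *: p + x' *: p' + y *: q + y' *: q') = 0 -> x = 0 /\ x' = 0.
  rewrite Lt_N => E; have [|/eqP] := @coordN (x' * eps) x 0 0; first by rewrite !scale0r !addr0.
  by rewrite mulf_eq0 (negPf eps0) orbF => /eqP -> ->.
have Q_eq0 x x' y y' : L s (x *: p + x' *: p' + y *: q + y' *: q') = 0 -> y = 0 /\ y' = 0.
  rewrite Ls_N => E; have [|_ _ /eqP] := @coordN 0 0 (y' * del) y.
    by rewrite !scale0r !add0r.
  by rewrite mulf_eq0 (negPf del0) orbF => /eqP -> ->.
exfalso; case: (cscale_eq0 JJ kk') => [/eqP|/eqP]; last by rewrite (negPf m0).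
rewrite mulf_eq0 => /orP[] /eqP k0.
  have Lt0 : L t m = 0 by rewrite kE k0 cscale0r.
  have LtJ0 : L t (J m) = 0 by rewrite LJ // Lt0 lf0.
  rewrite mE in Lt0; rewrite JmE in LtJ0.
  have [a0 b0] := P_eq0 _ _ _ _ Lt0; have [a0' b0'] := P_eq0 _ _ _ _ LtJ0.
  apply: (@stable_plane_absurd s m q q'); rewrite ?LJ //.
  - apply: contraNneq m0 => Ls0; rewrite mE in Ls0; have [c0 d0] := Q_eq0 _ _ _ _ Ls0.
    by rewrite mE a0 b0 c0 d0 !scale0r !addr0.
  - by rewrite mE a0 b0 !scale0r !add0r mem_plane.
  - by rewrite JmE a0' b0' !scale0r !add0r mem_plane.
have Ls0 : L s m = 0 by rewrite k'E k0 cscale0r.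
have LsJ0 : L s (J m) = 0 by rewrite LJ // Ls0 lf0.
rewrite mE in Ls0; rewrite JmE in LsJ0.
have [c0 d0] := Q_eq0 _ _ _ _ Ls0; have [c0' d0'] := Q_eq0 _ _ _ _ LsJ0.
apply: (@stable_plane_absurd t m p p'); rewrite ?LJ //.
- apply: contraNneq m0 => Lt0; rewrite mE in Lt0; have [a0 b0] := P_eq0 _ _ _ _ Lt0.
  by rewrite mE a0 b0 c0 d0 !scale0r !addr0.
- by rewrite mE c0 d0 !scale0r !addr0 mem_plane.
- by rewrite JmE c0' d0' !scale0r !addr0 mem_plane.
Qed.

(** Write J t = al t + be s modulo N.  Then rho t is
    (1 + al J) ad t on the first plane and be J ad s on the second one, so its
    square is eps (1 + al J)^2 there and - be^2 del here.  Both are the same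
    complex scalar k, so al = 0 and eps = - be^2 del. *)
Lemma two_plane_signs : exists2 r : R, r != 0 & eps = - (r ^+ 2 * del).
Proof.
have JN := N_stable.
have [al [be [n [nN Jt]]]] := V_split (J t).
(* otherwise (J - al) t, and then also (1 + al^2) t, would be in N *)
have be0 : be != 0.
  apply: contraNneq t_notin => be0; rewrite be0 scale0r addr0 in Jt.
  have E : (1 + al ^+ 2) *: t = - (al *: n + J n).
    have JJt : - t = al *: (al *: t + n) + J n by rewrite -JJ {1}Jt lfD lfZ Jt.
    apply: scalar_ext => f; move: (congr1 f JJt); rewrite !scE => h.
    rewrite mulrDl mul1r -mulrA; lra.
  have a0 : 1 + al ^+ 2 != 0 by rewrite gt_eqF // ltr_pwDl // sqr_ge0.
  by rewrite -[t](scalerK a0) E memvZ // memvN memvD ?JN // memvZ.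
have rhoN y : y \in N -> rho t y = L t y + al *: J (L t y) + be *: J (L s y).
  by move=> yN; rewrite rhoE Jt !brDl (N_abel nN yN) addr0 !brZl !lfE addrA.
have [u [v [[_ _ uv _] NE]]] : exists u v, [/\ u \in N, v \in N, cindep2 J u v & (3 < \dim N)%N] /\
    (\dim N = 4%N -> N = <<[:: u; J u; v; J v]>>%VS).
  by apply: stable_dim_gt2 => //; rewrite dimN.
have {}NE := NE dimN.
have [|k kE] := @rho_square _ _ _ _ JJ nij0 dimV uni trJ t u v uv.
  by move=> y; apply: cplane_mem; rewrite -NE rhoE memvD ?JN ?br_N.
have rr y : y \in N -> rho t (rho t y) = k *j y.
  by rewrite {1}NE => /cplane_mem[a [b ->]]; exact: kE.
have inN : [/\ p \in N, p' \in N, q \in N & q' \in N].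
  by split; rewrite memv_span // !inE eqxx ?orbT.
case: inN => pN p'N qN q'N; have [[_ sp sp' tq tq'] _] := brackets.
have rho_p : rho t p = p' + al *: J p' by rewrite rhoN // tp sp lf0 scaler0 addr0.
have rho_p' : rho t p' = eps *: p + (al * eps) *: J p.
  by rewrite rhoN // tp' sp' !lfE scaler0 addr0 scalerA.
have rho_q : rho t q = be *: J q' by rewrite rhoN // tq sq lf0 scaler0 !add0r.
have rho_q' : rho t q' = (be * del) *: J q.
  by rewrite rhoN // tq' sq' !lfE scaler0 !add0r scalerA.
have rhoZ a y : rho t (a *: y) = a *: rho t y by rewrite -!(cscaleR J) rhoZr.
have kq : (k + (be ^+ 2 * del)%:C%C) *j q = 0.
  rewrite cscaleDl -rr // rho_q rhoZ rhoJr // rho_q' !lfE JJ cscaleR; vring.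
have q0 : q != 0.
  by apply: contraTneq freeN => q0; rewrite q0; apply/negP => /(free_not0 (v := 0)); rewrite !inE eqxx ?orbT => /(_ isT).
have kv : k = - (be ^+ 2 * del)%:C%C.
  case: (cscale_eq0 JJ kq) => /eqP; last by rewrite (negPf q0).
  by rewrite addr_eq0 => /eqP.
have p0 : p != 0.
  by apply: contraTneq freeN => p0; rewrite p0; apply/negP => /(free_not0 (v := 0)); rewrite !inE eqxx ?orbT => /(_ isT).
have kp : ((eps * (1 - al ^+ 2) + be ^+ 2 * del) +i* (2 * eps * al))%C *j p = 0.
  have := rr p pN; rewrite rho_p rhoDr rhoZ rhoJr // rho_p' kv cscaleNl cscaleR => E.
  by rewrite cscaleE /= -[RHS](subrr (- ((be ^+ 2 * del) *: p))) -{1}E !lfE JJ; vring.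
case: (cscale_eq0 JJ kp) => [[e1 e2]|/eqP]; last by rewrite (negPf p0).
have al0 : al = 0.
  by move/eqP: e2; rewrite !mulf_eq0 pnatr_eq0 (negPf eps0) => /eqP.
exists be => //; move: e1; rewrite al0 expr0n subr0 mulr1 => /eqP.
by rewrite addr_eq0 => /eqP.
Qed.
End TwoPlaneFactors.

(** * Factors with a centre *)
Section FactorsWithCentre.
Variables (R : realType) (V : vectType R) (L : lieBracket V) (J : 'End(V)).
Hypothesis JJ : forall x, J (J x) = - x.
Hypothesis nij0 : forall x y, nijenhuis L J x y = 0.
Hypothesis dimV : \dim {:V} = 6%N.
Hypothesis uni : unimodular L.
Hypothesis trJ : forall x, lfun_trace (J \o ad L x)%VF = 0.
Hypothesis nonnil : ~ nilpotent L.

Definition A57_or_A517 :=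
  lie_isomorphic L (A57_R R) \/ exists a : R, 0 <= a /\ lie_isomorphic L (A517_R a).

Lemma central_outside_derived z (U : {vspace V}) : (forall x, L z x = 0) ->
  (forall x y, L x y \in U) -> z \notin U -> A57_or_A517.
Proof.
move=> zc LU /separating_scalar[zeta [zeta_z zetaU]].
by apply: (central_factor_classification JJ nij0 dimV uni trJ zc zeta_z) => // x y; apply: zetaU.
Qed.

Lemma abelian_factor (b c : {vspace V}) : direct_product L b c -> b != 0%VS ->
  (forall x y, x \in b -> y \in b -> L x y = 0) -> A57_or_A517.
Proof.
move=> bc b0 abel; have zb := memv_pick b; have := b0; rewrite -vpick0.
move: (vpick b) zb => z zb z0; apply: (@central_outside_derived z c).
- move=> x; have [y [w [yb wc ->]]] := factor_split bc x.
  by rewrite brDr abel // (factor_comm bc) // addr0.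
- move=> x x'; have [y [w [yb wc ->]]] := factor_split bc x.
  have [y' [w' [yb' wc' ->]]] := factor_split bc x'.
  rewrite !brE abel // (factor_comm bc yb wc') (factor_commC bc yb' wc) !add0r.
  by case: bc => _ ic _ _; apply: ic.
- by apply: contra z0 => zc; rewrite (factor_cap bc zb zc).
Qed.

Lemma heisenberg_times_heisenberg (b c : {vspace V}) : direct_product L b c ->
  heisenberg_factor L b -> heisenberg_factor L c -> nilpotent L.
Proof.
move=> bc [p [p0 pb pc Lp]] [q [q0 qc qcen Lq]].
apply: (@nilpotent_of_chain _ _ _ (<[p]> + <[q]>)%VS 0%VS).
- move=> x x'; have [y [w [yb wc ->]]] := factor_split bc x.
  have [y' [w' [yb' wc' ->]]] := factor_split bc x'.
  rewrite !brE (factor_comm bc yb wc') (factor_commC bc yb' wc) addr0 add0r.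
  by rewrite memv_add ?Lp ?Lq.
- move=> x _ /memv_addP[_ /vlineP[r ->] [_ /vlineP[s ->] ->]].
  by rewrite brC !brE pc qcen !scaler0 addr0 oppr0 mem0v.
- by move=> x y; rewrite memv0 => /eqP ->; rewrite br0r.
Qed.

(** Let w = J z, so that ad w commutes with J and its image I is J-stable.
    If w has a component along s, then I is the plane of c, which
    [stable_plane_absurd] forbids.  If its component in the plane is non-zero,
    then I has dimension at least 2 and is spanned by z and h = [w, s]; so w lies
    in I, and this confines I to a line.  Hence w is in the Heisenberg factor, I is in
    the real line of z and thus zero, and w is a central vector outside the
    derived algebra. *)
Lemma heisenberg_times_plane (b c : {vspace V}) (del : R) : direct_product L b c ->
  heisenberg_factor L b -> plane_factor L c del -> del != 0 -> A57_or_A517.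
Proof.
move=> bc [z [z0 zb zc Lz]] [s [q [q' [cE cf qq' sq sq']]]] del0.
pose w := J z; pose I := limg (ad L w).
have LJ y : L w (J y) = J (L w y).
  by have := nijE nij0 z y; rewrite !zc lf0 addr0 add0r.
have JI : J_stable J I.
  move=> _ /memv_imgP[y _ ->]; rewrite adE -LJ -adE; exact: memv_img (memvf _).
have wI y : L w y \in I by rewrite -adE memv_img // memvf.
have inc : [/\ s \in c, q \in c & q' \in c].
  by rewrite cE; split; rewrite memv_span // !inE eqxx ?orbT.
case: inc => sc qc q'c.
have c_split x : x \in c -> exists r m n, x = r *: s + (m *: q + n *: q').
  rewrite cE span_cons => /memv_addP[_ /vlineP[r ->] [_ /plane_mem[m [n ->]] ->]].
  by exists r, m, n.
have [wb [_ [wbb /c_split[g [al [be ->]]] wE]]] := factor_split bc w.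
have q'q : L q' q = 0 by rewrite brC qq' oppr0.
have qs : L q s = - q' by rewrite brC sq.
have q's : L q' s = - (del *: q) by rewrite brC sq'.
have Lc r m n r' m' n' : L (r *: s + (m *: q + n *: q')) (r' *: s + (m' *: q + n' *: q')) =
    ((r * n' - n * r') * del) *: q + (r * m' - m * r') *: q'.
  by rewrite !brE !bracket_alt qq' q'q sq sq' qs q's; vring.
have c_mem r m n : r *: s + (m *: q + n *: q') \in c by rewrite !memvD ?memvZ.
have Lw yb r m n : yb \in b -> L w (yb + (r *: s + (m *: q + n *: q'))) =
    L wb yb + (((g * n - be * r) * del) *: q + (g * m - al * r) *: q').
  move=> ybb; rewrite wE (brDl L wb) (brDr L wb) (brDr L _ yb) (factor_comm bc wbb (c_mem _ _ _)).
  by rewrite (factor_commC bc ybb (c_mem _ _ _)) Lc addr0 add0r.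
have V_split x : exists y r m n, y \in b /\ x = y + (r *: s + (m *: q + n *: q')).
  have [y [_ [yb /c_split[r [m [n ->]]] ->]]] := factor_split bc x.
  by exists y, r, m, n.
have br_U x x' : L x x' \in <<[:: z; q; q']>>%VS.
  have [y [r [m [n [yb ->]]]]] := V_split x; have [y' [r' [m' [n' [yb' ->]]]]] := V_split x'.
  rewrite (brDl L y) (brDr L y) (brDr L _ y') (factor_comm bc yb (c_mem _ _ _)).
  rewrite (factor_commC bc yb' (c_mem _ _ _)) Lc addr0 add0r span_cons.
  by rewrite memv_add ?Lz ?mem_plane.
have indQ m n : m *: q + n *: q' = 0 -> m = 0 /\ n = 0.
  by apply: (free2P q q').2; move: cf; rewrite free_cons => /andP[].
have span_dim (X : seq V) : (\dim <<X>> <= size X)%N := dim_span X.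
have I_dim2 m : m \in I -> m != 0 -> (<<[:: m; J m]>> <= I)%VS /\ (1 < \dim I)%N.
  move=> mI m0; have sub : (<<[:: m; J m]>> <= I)%VS.
    by apply/span_subvP => x; rewrite !inE => /orP[] /eqP->; rewrite ?JI.
  by split=> //; have := dimvS sub; rewrite (eqP (free_cline JJ m0)).
have [g0|gn0] := eqVneq g 0; last first.
  exfalso; have Lwq : L w q = g *: q'.
    have := Lw 0 0 1 0 (mem0v b); rewrite !scale0r scale1r !add0r addr0 => ->.
    by rewrite br0r !(mulr0, mulr1, oppr0, subr0, mul0r, scale0r, add0r).
  have Lwq' : L w q' = (g * del) *: q.
    have := Lw 0 0 0 1 (mem0v b); rewrite !scale0r scale1r !add0r => ->.
    by rewrite br0r !(mulr0, mulr1, oppr0, subr0, mul0r, scale0r, add0r, addr0).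
  have QI : (<<[:: q; q']>> <= I)%VS.
    have gd : g * del != 0 by rewrite mulf_neq0.
    apply/span_subvP => x; rewrite !inE => /orP[] /eqP->.
      by rewrite -[q](scalerK gd) -Lwq' memvZ.
    by rewrite -[q'](scalerK gn0) -Lwq memvZ.
  have IU : (I <= <<[:: z; q; q']>>)%VS.
    by apply/subvP => _ /memv_imgP[y _ ->]; rewrite adE.
  have dI : (\dim I <= 2)%N.
    rewrite leqNgt; apply/negP => /(stable_dim_gt2 JJ JI)[x [y [[_ _ _ dI] _]]].
    by have := leq_trans dI (leq_trans (dimvS IU) (span_dim _)).
  have QE : <<[:: q; q']>>%VS = I.
    by apply/eqP; rewrite eqEdim QI (eqP ((free2P q q').1 indQ)).
  apply: (@stable_plane_absurd _ _ _ _ JJ uni trJ w q q q') => //.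
  - rewrite Lwq scaler_eq0 (negPf gn0) /=; apply/eqP => q'0.
    have [|_ /eqP] := indQ 0 1; first by rewrite q'0 scaler0 scale0r addr0.
    by rewrite oner_eq0.
  - by rewrite memv_span // !inE eqxx.
  - by rewrite QE JI // -QE memv_span // !inE eqxx.
  - by move=> y; rewrite QE.
pose h := (- be * del) *: q + (- al) *: q'.
have Lws : L w s = h.
  have := Lw 0 1 0 0 (mem0v b); rewrite !scale0r scale1r !add0r addr0 => ->.
  by rewrite br0r g0 !(mulr1, mulr0, oppr0, mul0r, sub0r, add0r).
have [h0|hn0] := eqVneq h 0; last first.
  exfalso; have hI : h \in I by rewrite -Lws.
  have [sub dI] := I_dim2 h hI hn0.
  have Izh : (I <= <<[:: z; h]>>)%VS.
    apply/subvP => _ /memv_imgP[x _ ->]; rewrite adE.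
    have [y [r [m [n [yb ->]]]]] := V_split x; rewrite Lw // g0.
    have /vlineP[k ->] := Lz _ _ wbb yb.
    have -> : ((0 * n - be * r) * del) *: q + (0 * m - al * r) *: q' = r *: h.
      by rewrite /h; vring.
    exact: mem_plane.
  have IE : I = <<[:: z; h]>>%VS.
    by apply/eqP; rewrite eqEdim Izh (leq_trans (span_dim [:: z; h]) dI).
  have /plane_mem[x [y wzh]] : w \in <<[:: z; h]>>%VS.
    by rewrite -IE; apply: JI; rewrite IE memv_span // !inE eqxx.
  have : (I <= <[L h s]>)%VS.
    apply/subvP => _ /memv_imgP[v _ ->]; rewrite adE.
    have [yb [r [m [n [ybb ->]]]]] := V_split v.
    have hE : h = 0 *: s + ((- be * del) *: q + (- al) *: q') by rewrite scale0r add0r.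
    have hc : h \in c by rewrite hE c_mem.
    have -> : L w (yb + (r *: s + (m *: q + n *: q'))) = (y * r) *: L h s.
      rewrite wzh (brDl L _ (y *: h)) !brZl zc scaler0 add0r (brDr L h) (factor_commC bc ybb hc) add0r.
      have sE : s = 1 *: s + (0 *: q + 0 *: q') by rewrite scale1r !scale0r !addr0.
      rewrite [in RHS]sE hE !Lc; vring.
    by rewrite memvZ // memv_line.
  move/dimvS; rewrite dim_vline leqNgt => /negP; apply.
  by apply: leq_trans dI; rewrite ltnS; case: eqP.
have [al0 be0] : al = 0 /\ be = 0.
  by have [/eqP] := indQ _ _ h0; rewrite mulf_eq0 (negPf del0) orbF !oppr_eq0 => /eqP-> /eqP; rewrite oppr_eq0 => /eqP.
have Lw_z y : L w y \in <[z]>%VS.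
  have [yb [r [m [n [ybb ->]]]]] := V_split y; rewrite Lw // g0 al0 be0.
  by rewrite !mul0r subrr mul0r !scale0r !addr0 Lz.
have wc y : L w y = 0.
  apply/eqP; apply: contraT => n0; have [_] := I_dim2 _ (wI y) n0.
  have : (I <= <[z]>)%VS by apply/subvP => _ /memv_imgP[x _ ->]; rewrite adE.
  by move/dimvS; rewrite dim_vline z0 leqNgt => /negPf->.
have wb' : w \in b by rewrite wE g0 al0 be0 !scale0r !addr0.
apply: (@central_outside_derived w <<[:: z; q; q']>>) => //.
apply/negP; rewrite span_cons => /memv_addP[_ /vlineP[x ->] [v vQ wzv]].
have v0 : v = 0.
  apply: (factor_cap bc).
    by rewrite -[v](addKr (x *: z)) -wzv memvD // memvN memvZ.
  by have [m [n ->]] := plane_mem vQ; rewrite -[_ + _]add0r -(scale0r s) c_mem.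
have [|_ /eqP] := (free2P z (J z)).2 (free_cline JJ z0) (- x) 1.
  by rewrite -/w wzv v0 addr0 scaleNr scale1r addNr.
by rewrite oner_eq0.
Qed.
End FactorsWithCentre.

(** * The classification *)
Section ThreeDimensionalFactors.
Variables (R : realType) (V : vectType R) (L : lieBracket V) (J : 'End(V)).
Hypothesis JJ : forall x, J (J x) = - x.
Hypothesis nij0 : forall x y, nijenhuis L J x y = 0.
Hypothesis dimV : \dim {:V} = 6%N.
Hypothesis uni : unimodular L.
Hypothesis trJ : forall x, lfun_trace (J \o ad L x)%VF = 0.
Hypothesis nonnil : ~ nilpotent L.

Lemma small_factor (b c : {vspace V}) : direct_product L b c -> b != 0%VS ->
  (\dim b <= 2)%N -> A57_or_A517 L.
Proof.
move=> bc b0 db; apply: (abelian_factor JJ nij0 dimV uni trJ nonnil bc b0) => x y xb yb.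
have [/(ideal_plane_abelian uni)|d2] := eqVneq (\dim b) 2; first by apply=> //; case: bc.
have /dim1_basis[p [_ bE]] : \dim b = 1%N.
  by move: b0 db d2; rewrite -dimv_eq0; case: (\dim b) => [|[|[|]]].
move: xb yb; rewrite bE => /vlineP[r ->] /vlineP[s ->].
by rewrite !brE bracket_alt !scaler0.
Qed.

Lemma factor3_cases (b c : {vspace V}) : solvable L -> direct_product L b c -> \dim b = 3%N ->
  [\/ forall x y, x \in b -> y \in b -> L x y = 0, heisenberg_factor L b |
      plane_factor L b 1 \/ plane_factor L b (-1)].
Proof.
move=> sol bc db; have b0 : b != 0%VS by rewrite -dimv_eq0 db.
have sub := bracketv_factor_sub bc; have := dimvS sub; rewrite db.
have := solvable_factor sol b0; rewrite eqEdim sub db /= -ltnNge.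
case dP : (\dim (bracketv L b b)) => [|[|[|//]]] _ _.
- apply: Or31 => x y xb yb; apply/eqP; rewrite -memv0.
  by move/eqP: dP; rewrite dimv_eq0 => /eqP <-; apply: bracketv_mem.
- by apply: Or32; apply: heisenberg_factor_of_dim1 bc uni dP.
- by apply: Or33; apply: plane_factor_of_dim2 bc uni db dP.
Qed.

Lemma plane_factors_free (b c : {vspace V}) (t p p' s q q' : V) : direct_product L b c ->
  b = <<[:: t; p; p']>>%VS -> free [:: t; p; p'] ->
  c = <<[:: s; q; q']>>%VS -> free [:: s; q; q'] -> free [:: t; s; p; p'; q; q'].
Proof.
case=> _ _ bc0 _ bE fb cE fc.
have : free ([:: t; p; p'] ++ [:: s; q; q']).
  by rewrite cat_free fb fc /= -bE -cE; apply/directv_addP.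
rewrite (perm_free (Y := [:: t; s; p; p'; q; q'])) //.
rewrite /= perm_cons; apply/permPl; exact: (perm_catCA [:: p; p'] [:: s] [:: q; q']).
Qed.

Lemma plane_factors_same_sign (b c : {vspace V}) (eps : R) : direct_product L b c ->
  plane_factor L b eps -> plane_factor L c eps -> eps != 0 -> False.
Proof.
move=> bc [t [p [p' [bE fb pp' tp tp']]]] [s [q [q' [cE fc qq' sq sq']]]] e0.
have f6 := plane_factors_free bc bE fb cE fc.
have comm x y : x \in [:: t; p; p'] -> y \in [:: s; q; q'] -> L x y = 0.
  by move=> xb yc; apply: (factor_comm bc); rewrite ?bE ?cE memv_span.
have [r r0 E] := two_plane_signs JJ nij0 dimV uni trJ f6 e0 e0 comm pp' qq' tp tp' sq sq'.
have : (1 + r ^+ 2) * eps = 0 by rewrite mulrDl mul1r {1}E addNr.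
move/eqP; rewrite mulf_eq0 (negPf e0) orbF => /eqP r1.
by have := sqr_ge0 r; move: r1 => /eqP; rewrite addrC addr_eq0 => /eqP->; rewrite oppr_ge0 ler10.
Qed.

(** The sign of p' is reversed because e(2) is written with
    [e_1, e_2] = - e_3. *)
Lemma plane_factors_iso (b c : {vspace V}) : direct_product L b c ->
  plane_factor L b (-1) -> plane_factor L c 1 -> lie_isomorphic L (e2_e11 R).
Proof.
move=> bc [t [p [p' [bE fb pp' tp tp']]]] [s [q [q' [cE fc qq' sq sq']]]].
have inb : [/\ t \in b, p \in b & p' \in b] by rewrite bE; split; rewrite memv_span // !inE eqxx ?orbT.
case: inb => tb pb p'b.
apply: (@iso_e2_e11 _ _ _ dimV t p (- p') s q q') => //.
- move=> U tU pU p'U sU qU q'U; case: (bc) => _ _ _ <-; rewrite bE cE subv_add.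
  rewrite memvN in p'U; apply/andP; split.
    by apply/span_subvP => x; rewrite !inE => /or3P[] /eqP->.
  by apply/span_subvP => x; rewrite !inE => /or3P[] /eqP->.
- move=> x y xb yc; apply: (factor_comm bc); last by rewrite cE memv_span.
  by move: xb; rewrite !inE => /or3P[] /eqP->; rewrite ?memvN.
- by rewrite brNr pp' oppr0.
- by rewrite opprK.
- by rewrite brNr tp' scaleN1r opprK.
- by rewrite sq' scale1r.
Qed.

End ThreeDimensionalFactors.

Theorem proposition2p6 (R : realType) (V : vectType R) (L : lieBracket V)
    (hdim : \dim {:V} = 6%N)
    (hdec : decomposable L)
    (huni : unimodular L)
    (hnil : ~ nilpotent L)
    (hsol : solvable L)
    (hJ : exists J : 'End(V),
      complex_structure L J /\ has_nonzero_closed_30_form L J) :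
  [\/ lie_isomorphic L (e2_e11 R),
      lie_isomorphic L (A57_R R) |
      exists a : R, 0 <= a /\ lie_isomorphic L (A517_R a)].
Proof.
have [J [[JJ nij0] form]] := hJ.
have trJ x := trace_J_ad JJ nij0 hdim huni x form.
suff : lie_isomorphic L (e2_e11 R) \/ A57_or_A517 L.
  by case=> [|[]]; [apply: Or31|apply: Or32|apply: Or33].
have [b [c [ib ic b0 c0 [dir bcf]]]] := hdec.
have bc : direct_product L b c by split=> //; apply/directv_addP.
have cb := direct_productC bc.
have ab := abelian_factor JJ nij0 hdim huni trJ hnil.
have dsum : (\dim b + \dim c = 6)%N.
  by rewrite -hdim -bcf dimv_disjoint_sum //; apply/directv_addP.
have [db|db] := leqP (\dim b) 2.
  by right; apply: (small_factor JJ nij0 hdim huni trJ hnil bc).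
have [dc|dc] := leqP (\dim c) 2.
  by right; apply: (small_factor JJ nij0 hdim huni trJ hnil cb).
have db3 : \dim b = 3%N.
  by apply/eqP; rewrite eqn_leq db andbT -(leq_add2r (\dim c)) dsum -[6%N]/(3 + 3)%N leq_add2l.
have dc3 : \dim c = 3%N by move/eqP: dsum; rewrite db3 -[6%N]/(3 + 3)%N eqn_add2l => /eqP.
have same e := @plane_factors_same_sign _ _ _ _ JJ nij0 hdim huni trJ b c e bc.
have hp := heisenberg_times_plane JJ nij0 hdim huni trJ hnil.
have nz : (-1 != 0 :> R) * (1 != 0 :> R) by rewrite oppr_eq0 oner_eq0.
case: (factor3_cases huni hsol bc db3) => [bab|bh|bp].
- by right; apply: ab bc b0 bab.
- right; case: (factor3_cases huni hsol cb dc3) => [cab|ch|[cp|cp]].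
  + by apply: ab cb c0 cab.
  + by case: hnil; apply: heisenberg_times_heisenberg bc bh ch.
  + by apply: hp bc bh cp _; rewrite nz.
  + by apply: hp bc bh cp _; rewrite nz.
case: (factor3_cases huni hsol cb dc3) => [cab|ch|cp].
- by right; apply: ab cb c0 cab.
- by right; case: bp => bp; apply: hp cb ch bp _; rewrite nz.
case: bp cp => bp [] cp.
- by case: (same _ bp cp); rewrite nz.
- by left; apply: plane_factors_iso cb cp bp.
- by left; apply: plane_factors_iso bc bp cp.
- by case: (same _ bp cp); rewrite nz.
Qed.
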